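(* There exists an absolute constant $C>0$ such that for infinitely many positive integers $n$, one has, for all positive integers $k$, $$\omega(n+k)\le \Omega(n+k)\le Ck.$$ In particular, for such $n$ one has $\tau(n+k)\le 2^{Ck}$ for all positive integers $k$.
   Context: $\omega(m)$ denotes the number of distinct prime divisors of $m$; $\Omega(m)=\sum_p \nu_p(m)$ denotes the number of prime divisors of $m$ counted with multiplicity, where $\nu_p(m)$ is the exponent of the prime $p$ in $m$; $\tau(m)$ denotes the number of positive divisors of $m$. *)

(* Defs.v *)
From mathcomp Require Import all_boot.
From Stdlib Require Import Reals.

Definition omega (m : nat) : nat := size (primes m).
Definition Omega (m : nat) : nat := \sum_(p <- primes m) logn p m.
Definition tau (m : nat) : nat := size (divisors m).

(* Main.v *)
(* Brun-Hooley sieve.  Let L = 2 ^ (R - 5), M = 2 ^ 2 ^ R with R large, let Q be the product of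
   the prime powers p ^ (e + 1) with p <= L and p ^ e <= L < p ^ (e + 1), and look for n = Q m,
   1 <= m <= M.  For k > L the bound Omega (n + k) = O(k) is the trivial logarithmic one.  For
   k <= L the primes p <= L contribute only Omega k <= k to Omega (n + k), because
   v_p (n + k) = v_p k, and a prime p > L divides at most one of n + 1, ..., n + L.

   Put z_k = 2 ^ 2 ^ (R - 20 - k).  It suffices to find m such that, for all k <= L, no prime of
   (L, z_k] divides n + k and n + k has fewer than T k prime factors p > z_k with
   p ^ (8 T k) <= M; there are at most 16 T k prime factors beyond that size.  Since z_k decreases
   doubly exponentially in k, only O(j) classes are sieved at the primes of size
   M ^ (1 / 2 ^ j), so that a sieve of bounded level applies.  The primes are cut into blocks of
   small total density, and m is weighted by the product over the blocks of
   1 - N + C(N, 2) >= 0, where N counts the primes of the block that divide some n + k from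
   which they are sieved.
   Under this weight some N is nonzero with probability < 1/4, and by Rankin's trick some n + k
   has T k prime factors of medium size with probability < 1/4. *)

Require Import Defs.
From mathcomp Require Import all_boot.
From Stdlib Require Import Reals.
(* [all_boot] again: its notations on [nat] must take precedence over those of [Reals]. *)
From mathcomp Require Import all_boot all_order all_algebra zify ring lra.
Set Implicit Arguments. Unset Strict Implicit. Unset Printing Implicit Defensive.
Import Order.TTheory GRing.Theory Num.Theory.

Section Development.

Local Open Scope nat_scope.

(* Sealing [rat] keeps conversion from computing with rational numbers. *)
Definition QQ : realFieldType. Proof. exact: rat. Qed.

(** * Chebyshev bounds *)

Definition primes_in (a b : nat) : seq nat := [seq p <- index_iota a.+1 b.+1 | prime p].

Lemma mem_primes_in a b p : (p \in primes_in a b) = [&& prime p, a < p & p <= b].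
Proof. by rewrite mem_filter mem_index_iota ltnS. Qed.

Lemma primes_in_uniq a b : uniq (primes_in a b).
Proof. by rewrite filter_uniq // iota_uniq. Qed.

Lemma primes_in_cat a b c : a <= b -> b <= c ->
  primes_in a c = primes_in a b ++ primes_in b c.
Proof.
move=> ab bc; rewrite /primes_in -filter_cat; congr filter.
rewrite /index_iota; have -> : c.+1 - a.+1 = (b.+1 - a.+1) + (c.+1 - b.+1) by lia.
by rewrite iotaD; congr (_ ++ iota _ _); lia.
Qed.

Lemma prod_primes_dvd (s : seq nat) m : uniq s -> all prime s ->
  {in s, forall p, p %| m} -> \prod_(p <- s) p %| m.
Proof.
elim: s => [|p s IH] /=; first by rewrite big_nil dvd1n.
move=> /andP[ps us] /andP[pp als] H; rewrite big_cons Gauss_dvd; last first.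
  rewrite prime_coprime // Euclid_dvd_prod // big_has.
  apply/hasPn => q qs; rewrite dvdn_prime2 //; last exact: (allP als).
  by apply: contraNneq ps => ->.
by rewrite H ?mem_head // IH // => q qs; apply: H; rewrite in_cons qs orbT.
Qed.

Lemma bin_le_exp2 n m : 'C(n, m) <= 2 ^ n.
Proof.
case: (leqP m n) => [mn|/bin_small-> //].
have := expnDn 1 1 n; rewrite addn1 => ->.
rewrite (bigD1 (inord m : 'I_n.+1)) //= !exp1n !muln1 inordK ?ltnS //.
by rewrite leq_addr.
Qed.

Lemma prime_dvd_fact n p : prime p -> p %| n`! -> p <= n.
Proof.
move=> pp; elim: n => [|n IH]; first by rewrite dvdn1 => /eqP p1; rewrite p1 in pp.
rewrite factS Euclid_dvdM // => /orP[/dvdn_leq-> //|/IH]; exact: leqW.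
Qed.

Lemma prime_dvd_central_bin n p : prime p -> n < p -> p <= n.*2 -> p %| 'C(n.*2, n).
Proof.
move=> pp np p2n.
have nF : ~~ (p %| n`!) by apply/negP => /(prime_dvd_fact pp); rewrite leqNgt np.
have : p %| (n.*2)`! by rewrite dvdn_fact // prime_gt0.
rewrite -(bin_fact (leq_trans (leqnSn _) (_ : n.+1 <= n.*2))); last lia.
by rewrite -addnn addnK !Euclid_dvdM // (negbTE nF) !orbF.
Qed.

Lemma leq_prod_const (s : seq nat) a : {in s, forall x, a <= x} ->
  a ^ size s <= \prod_(x <- s) x.
Proof.
elim: s => [|x s IH] H; first by rewrite big_nil.
rewrite big_cons expnS leq_mul ?H ?mem_head // IH // => y ys.
by apply: H; rewrite in_cons ys orbT.
Qed.

(** The primes of the interval all divide a central binomial coefficient, which is at most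
    [2 ^ 2 ^ i.+1], and each of them exceeds [2 ^ i]. *)
Lemma size_primes_dyadic i : size (primes_in (2 ^ i) (2 ^ i.+1)) * i <= 2 ^ i.+1.
Proof.
rewrite -(leq_exp2l (m := 2)) // mulnC expnM.
apply: leq_trans (bin_le_exp2 (2 ^ i.+1) (2 ^ i)).
apply: leq_trans (_ : \prod_(p <- primes_in (2 ^ i) (2 ^ i.+1)) p <= _).
  by apply: leq_prod_const => p; rewrite mem_primes_in => /and3P[_ /ltnW].
apply: dvdn_leq; first by rewrite bin_gt0 leq_exp2l.
apply: prod_primes_dvd; rewrite ?primes_in_uniq ?filter_all // => p.
rewrite mem_primes_in => /and3P[pp lo hi].
by rewrite expnS mul2n in hi *; apply: prime_dvd_central_bin.
Qed.

Lemma size_primes_pow2 r : size (primes_in 0 (2 ^ r)) * r <= 6 * 2 ^ r.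
Proof.
elim: r => [|r IH]; first by rewrite muln0.
rewrite (@primes_in_cat 0 (2 ^ r)) ?leq_exp2l // size_cat.
have D := size_primes_dyadic r.
have [r1|r2] := leqP r 1; first by case: r r1 {IH D} => [|[]].
move: IH D; rewrite !expnS; move: (2 ^ r) => x.
move: (size _) (size _) => a b IH D.
(* The hypotheses give [(a + b) * r <= 8 * x], and hence [a + b <= 4 * x] as [r >= 2]; the two
   bounds add up to the required [12 * x]. *)
have : (a + b) * 2 <= 8 * x by nia.
nia.
Qed.

Local Open Scope ring_scope.

Lemma sum_const_le (T : eqType) (s : seq T) (f : T -> QQ) c :
  {in s, forall x, f x <= c} -> \sum_(x <- s) f x <= (size s)%:R * c.
Proof.
move=> H; rewrite big_seq; apply: le_trans (ler_sum _ H) _.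
by rewrite -big_seq big_const_seq count_predT iter_addr_0 mulr_natl.
Qed.

Lemma sum_inv_primes_dyadic i : (0 < i)%N ->
  \sum_(p <- primes_in (2 ^ i) (2 ^ i.+1)) p%:R^-1 <= 2 / i%:R :> QQ.
Proof.
move=> i0; have x0 : 0 < (2 ^ i)%:R :> QQ by rewrite ltr0n expn_gt0.
apply: le_trans (sum_const_le (c := (2 ^ i)%:R^-1) _) _ => [p|].
  rewrite mem_primes_in => /and3P[_ lo _].
  by rewrite lef_pV2 ?posrE // ?ler_nat ?ltr0n; lia.
rewrite ler_pdivrMr // mulrC mulrA ler_pdivlMr ?ltr0n // -!natrM ler_nat.
by rewrite [leqRHS]mulnC -expnS size_primes_dyadic.
Qed.

Lemma sum_inv_primes_block a m : (0 < a)%N ->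
  \sum_(p <- primes_in (2 ^ a) (2 ^ (a + m))) p%:R^-1 <= 2 * m%:R / a%:R :> QQ.
Proof.
move=> a0; elim: m => [|m IH].
  by rewrite addn0 mulr0 mul0r /primes_in /index_iota subnn big_nil.
rewrite addnS (@primes_in_cat _ (2 ^ (a + m))) ?leq_exp2l //; try lia.
rewrite big_cat /=.
apply: le_trans (lerD IH (sum_inv_primes_dyadic _)) _; first lia.
rewrite -(natr1 m) mulrDr mulrDl lerD2l mulr1 ler_pM2l //.
by rewrite lef_pV2 ?posrE ?ltr0n ?ler_nat; lia.
Qed.

(** A scale consists of [2 ^ s] dyadic intervals, each contributing at most [2 / 2 ^ s]. *)
Lemma sum_inv_primes_scale s :
  \sum_(p <- primes_in (2 ^ 2 ^ s) (2 ^ 2 ^ s.+1)) p%:R^-1 <= 2 :> QQ.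
Proof.
have := @sum_inv_primes_block (2 ^ s) (2 ^ s).
rewrite addnn -mul2n -expnS mulfK ?pnatr_eq0 -?lt0n ?expn_gt0 //; exact.
Qed.

Lemma sum_inv_primes_scales a m :
  \sum_(p <- primes_in (2 ^ 2 ^ a) (2 ^ 2 ^ (a + m))) p%:R^-1 <= 2 * m%:R :> QQ.
Proof.
elim: m => [|m IH].
  by rewrite addn0 mulr0 /primes_in /index_iota subnn big_nil.
rewrite addnS (@primes_in_cat _ (2 ^ 2 ^ (a + m))) ?leq_exp2l ?leq_addr ?leqnSn //.
rewrite big_cat /=; apply: le_trans (lerD IH (sum_inv_primes_scale _)) _.
by rewrite -(natr1 m) mulrDr mulr1.
Qed.

(** * Combinations of residue classes *)

Definition cong_sum (s : seq (QQ * (nat * nat))) (m : nat) : QQ :=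
  \sum_(t <- s) t.1 * (m == t.2.2 %[mod t.2.1])%:R.

(* [g] is a combination of indicators of residue classes whose moduli have all their prime
   factors in [P]; [mu] is its mean value over the integers, and [sigma] bounds the [l^1] norm of
   the coefficients, hence the error made when averaging over an interval. *)
Definition cong_poly (P : nat_pred) (g : nat -> QQ) (mu sigma : QQ) : Prop :=
  exists s : seq (QQ * (nat * nat)),
  [/\ g =1 cong_sum s, mu = \sum_(t <- s) t.1 / t.2.1%:R,
      \sum_(t <- s) `|t.1| <= sigma & all (fun t => P.-nat t.2.1) s].

Lemma cong_poly_ext P f g mu sigma :
  f =1 g -> cong_poly P f mu sigma -> cong_poly P g mu sigma.
Proof. by move=> fg [s [H1 H2 H3 H4]]; exists s; split=> // m; rewrite -fg. Qed.

Lemma cong_poly_le P f mu sigma tau :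
  sigma <= tau -> cong_poly P f mu sigma -> cong_poly P f mu tau.
Proof. by move=> st [s [H1 H2 H3 H4]]; exists s; split=> //; apply: le_trans st. Qed.

Lemma cong_poly_sub (P P' : nat_pred) f mu sigma :
  {subset P <= P'} -> cong_poly P f mu sigma -> cong_poly P' f mu sigma.
Proof.
move=> st [s [H1 H2 H3 H4]]; exists s; split=> //; apply: sub_all H4 => t.
by apply: sub_in_pnat => p _ /st.
Qed.

Lemma cong_poly_const P c : cong_poly P (fun=> c) c `|c|.
Proof.
exists [:: (c, (1%N, 0%N))]; split; rewrite ?big_seq1 ?divr1 //=.
by move=> m; rewrite /cong_sum big_seq1 /= !modn1 eqxx mulr1.
Qed.

Lemma cong_poly_cong (P : nat_pred) d a : P.-nat d ->
  cong_poly P (fun m => (m == a %[mod d])%:R) d%:R^-1 1.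
Proof.
move=> Pd; exists [:: (1, (d, a))]; split; rewrite ?big_seq1 ?mul1r ?normr1 //= ?Pd //.
by move=> m; rewrite /cong_sum big_seq1 /= mul1r.
Qed.

Lemma cong_polyD P f g mu nu sigma tau :
  cong_poly P f mu sigma -> cong_poly P g nu tau ->
  cong_poly P (fun m => f m + g m) (mu + nu) (sigma + tau).
Proof.
move=> [s [s1 -> s3 s4]] [t [t1 -> t3 t4]]; exists (s ++ t).
split; rewrite ?big_cat ?lerD ?all_cat ?s4 ?t4 //=.
by move=> m; rewrite /cong_sum big_cat s1 t1.
Qed.

Lemma cong_polyZ P c f mu sigma :
  cong_poly P f mu sigma ->
  cong_poly P (fun m => c * f m) (c * mu) (`|c| * sigma).
Proof.
move=> [s [s1 -> s3 s4]]; exists [seq (c * t.1, t.2) | t <- s].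
split; last by rewrite all_map.
- move=> m; rewrite s1 /cong_sum big_map mulr_sumr; apply: eq_bigr => t _.
  by rewrite mulrA.
- by rewrite big_map mulr_sumr; apply: eq_bigr => t _; rewrite mulrA.
- rewrite big_map (eq_bigr (fun t => `|c| * `|t.1|)) => [|t _]; last by rewrite normrM.
  by rewrite -mulr_sumr ler_wpM2l.
Qed.

(** Disjoint prime supports make the moduli coprime, so by the Chinese remainder theorem a product
    of two class indicators is again a class indicator, and its density is the product of the
    densities. *)
Lemma cong_polyM (P P' : nat_pred) f g mu nu sigma tau :
  (forall p, p \in P -> p \in P' -> false) ->
  cong_poly P f mu sigma -> cong_poly P' g nu tau ->
  cong_poly [predU P & P'] (fun m => f m * g m) (mu * nu) (sigma * tau).
Proof.
move=> PP' [s [s1 -> s3 s4]] [t [t1 -> t3 t4]].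
exists [seq (x.1 * y.1, (x.2.1 * y.2.1, chinese x.2.1 y.2.1 x.2.2 y.2.2)%N)
         | x <- s, y <- t]; split.
- move=> m; rewrite s1 t1 /cong_sum big_allpairs_dep big_distrlr /=.
  apply: eq_big_seq => x xs; apply: eq_big_seq => y yt.
  have cxy : coprime x.2.1 y.2.1.
    apply: pnat_coprime (allP s4 x xs) _.
    apply: sub_in_pnat (allP t4 y yt) => p _ pP'.
    by rewrite inE /=; apply/negP => pP; have := PP' p pP pP'.
  rewrite mulrACA -natrM mulnb (chinese_remainder cxy).
  by rewrite (chinese_modl cxy) (chinese_modr cxy).
- rewrite big_allpairs_dep big_distrlr /=.
  by apply: eq_bigr => x _; apply: eq_bigr => y _; rewrite natrM invfM; ring.
- rewrite big_allpairs_dep /=.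
  apply: le_trans (_ : (\sum_(x <- s) `|x.1|) * (\sum_(x <- t) `|x.1|) <= _).
    rewrite big_distrlr /=; apply: ler_sum => x _; apply: ler_sum => y _.
    by rewrite normrM.
  by apply: ler_pM => //; apply: sumr_ge0.
- apply/allP => z /allpairsP[[x y] [/= xs yt ->]] /=.
  rewrite pnatM; apply/andP; split.
  - by apply: sub_in_pnat (allP s4 x xs) => p _ pP; rewrite inE pP.
  - by apply: sub_in_pnat (allP t4 y yt) => p _ pP; rewrite inE pP orbT.
Qed.

Lemma count_cong M d a : (0 < d)%N ->
  (\sum_(0 <= m < M) (m == a %[mod d]) = (M + (d - 1 - a %% d)) %/ d)%N.
Proof.
move=> d0; have ad := ltn_pmod a d0.
elim: M => [|M IH]; first by rewrite big_geq // divn_small //; lia.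
rewrite big_nat_recr //= IH addSn divnS // addnC; congr (nat_of_bool _ + _)%N.
(* The quotient increases exactly when [M] lies in the class of [a]: here [d - a %% d] represents
   [-a] modulo [d]. *)
have -> : (M + (d - 1 - a %% d)).+1 = (M + (d - a %% d))%N by lia.
rewrite /dvdn -[in LHS](modn_mod a) -(eqn_modDr (d - a %% d)) -/(dvdn _ _).
by rewrite subnKC ?modnn // ltnW.
Qed.

Lemma count_cong_dist M d a : (0 < d)%N ->
  `|\sum_(0 <= m < M) (m == a %[mod d])%:R - M%:R / d%:R| <= 1 :> QQ.
Proof.
move=> d0; rewrite -natr_sum count_cong //.
have d0' : 0 < d%:R :> QQ by rewrite ltr0n.
rewrite -(ler_pM2r d0') mul1r -{2}(gtr0_norm d0') -normrM mulrBl divfK ?gt_eqF //.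
set q := (_ %/ _)%N; rewrite -natrM ler_norml.
have := divn_eq (M + (d - 1 - a %% d)) d; rewrite -/q.
have := ltn_pmod (M + (d - 1 - a %% d)) d0; have ad := ltn_pmod a d0.
move: (_ %% d)%N (q * d)%N => r n H1 H2.
have h1 : (n <= M + d)%N by lia.
have h2 : (M <= n + d)%N by lia.
by move: h1 h2; rewrite -!(ler_nat QQ) !natrD => h1 h2; apply/andP; split; lra.
Qed.

(** Each residue class is counted with an error at most 1, which is weighted by the absolute value
    of its coefficient. *)
Lemma cong_poly_sum P f mu sigma M : cong_poly P f mu sigma ->
  `|\sum_(0 <= m < M) f m - M%:R * mu| <= sigma.
Proof.
move=> [s [s1 -> s3 s4]]; apply: le_trans s3.
rewrite (eq_bigr (cong_sum s)) // exchange_big mulr_sumr -sumrB.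
apply: le_trans (ler_norm_sum _ _ _) _; rewrite big_seq [leRHS]big_seq.
apply: ler_sum => t ts; rewrite -mulr_sumr mulrCA -mulrBr normrM.
by rewrite ler_piMr // count_cong_dist //; case/andP: (allP s4 t ts).
Qed.

(** * Brun weights *)

Definition esym1 (v : nat -> QQ) (B : seq nat) : QQ := \sum_(p <- B) v p.

(** The second elementary symmetric polynomial; the product collects the pairs that contain the
    first element. *)
Fixpoint esym2 (v : nat -> QQ) (B : seq nat) : QQ :=
  if B is p :: B' then esym2 v B' + v p * esym1 v B' else 0.

(* For [v] with values 0 and 1, of which [N] are 1, this is [1 - N + C(N, 2)], i.e. 1 when [N = 0]
   and [C(N - 1, 2)] otherwise. *)
Definition brun (v : nat -> QQ) (B : seq nat) : QQ := 1 - esym1 v B + esym2 v B.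

Definition brun_prod (v : nat -> QQ) (Bs : seq (seq nat)) : QQ :=
  \prod_(B <- Bs) brun v B.

(* The sum over the blocks of [brun_prod] with the factor [brun] of that block replaced by [esym2];
   it dominates [brun_prod] wherever some event occurs. *)
Fixpoint brun_defect (v : nat -> QQ) (Bs : seq (seq nat)) : QQ :=
  if Bs is B :: Bs' then esym2 v B * brun_prod v Bs' + brun v B * brun_defect v Bs'
  else 0.

Lemma esym1_cons v p B : esym1 v (p :: B) = v p + esym1 v B.
Proof. by rewrite /esym1 big_cons. Qed.

Lemma brun_prod_cons v B Bs : brun_prod v (B :: Bs) = brun v B * brun_prod v Bs.
Proof. by rewrite /brun_prod big_cons. Qed.

Lemma esym1_ge0 v B : {in B, forall p, 0 <= v p} -> 0 <= esym1 v B.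
Proof. by move=> v0; rewrite /esym1 big_seq sumr_ge0. Qed.

(** The difference [esym1 ^+ 2 - 2 * esym2] is the sum of the squares of the values. *)
Lemma esym2_bounds v B : {in B, forall p, 0 <= v p} ->
  0 <= esym2 v B <= esym1 v B ^+ 2 / 2.
Proof.
elim: B => [|p B IH] v0; first by rewrite /esym1 big_nil expr0n mul0r lexx.
have vB : {in B, forall p, 0 <= v p} by move=> q qB; apply: v0; rewrite in_cons qB orbT.
have /andP[l r] := IH vB; have e0 := esym1_ge0 vB; have vp := v0 p (mem_head _ _).
rewrite esym1_cons /=; move: (v p) (esym1 v B) (esym2 v B) vp e0 l r => a e f a0 e0 l r.
by apply/andP; split; nra.
Qed.

Lemma brun_bounds v B : {in B, forall p, 0 <= v p} -> esym1 v B <= 1 / 2 ->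
  1 / 2 <= brun v B <= 1.
Proof.
move=> v0 h; have /andP[l r] := esym2_bounds v0; have e0 := esym1_ge0 v0.
by rewrite /brun; move: (esym1 v B) (esym2 v B) h l r e0 => e f h l r e0; apply/andP; split; nra.
Qed.

Lemma esym1_filter v B (a : pred nat) : {in B, forall p, ~~ a p -> v p = 0} ->
  esym1 v (filter a B) = esym1 v B.
Proof.
move=> H; rewrite /esym1 big_filter big_mkcond !big_seq; apply: eq_bigr => p pB.
by case: ifP => // /negbT /(H _ pB).
Qed.

Lemma esym2_filter v B (a : pred nat) : {in B, forall p, ~~ a p -> v p = 0} ->
  esym2 v (filter a B) = esym2 v B.
Proof.
elim: B => //= p B IH H.
have HB : {in B, forall p, ~~ a p -> v p = 0} by move=> q qB; apply: H; rewrite in_cons qB orbT.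
case: ifP => [ap|/negbT/(H p (mem_head _ _)) ->] /=; rewrite ?IH ?mul0r ?addr0 //.
by rewrite esym1_filter.
Qed.

Lemma esym_bool (X : nat -> bool) B :
  esym1 (fun p => (X p)%:R) B = (count X B)%:R /\
  esym2 (fun p => (X p)%:R) B = ((count X B)%:R ^+ 2 - (count X B)%:R) / 2.
Proof.
elim: B => [|p B [IH1 IH2]]; first by rewrite /esym1 big_nil /= expr0n subrr mul0r.
rewrite esym1_cons /= IH1 IH2 natrD; split => //.
by case: (X p); rewrite /=; field.
Qed.

Lemma brun_bool_ge0 (X : nat -> bool) B : 0 <= brun (fun p => (X p)%:R) B.
Proof.
rewrite /brun; have [-> ->] := esym_bool X B.
case: (count X B) => [|[|n]]; [lra|lra|rewrite -addn2 natrD].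
by have : 0 <= n%:R :> QQ by []; move: (n%:R) => x x0; nra.
Qed.

Lemma esym2_bool_ge0 (X : nat -> bool) B : 0 <= esym2 (fun p => (X p)%:R) B.
Proof. by have /andP[] := @esym2_bounds (fun p => (X p)%:R) B (fun p _ => ler0n _ _). Qed.

(** The left side minus the right side is [1 - N], where [N >= 1] is the number of events in the
    block. *)
Lemma brun_bool_le_esym2 (X : nat -> bool) B : has X B ->
  brun (fun p => (X p)%:R) B <= esym2 (fun p => (X p)%:R) B.
Proof.
rewrite has_count /brun => c0; have [-> ->] := esym_bool X B.
by move: c0; rewrite -(ler_nat QQ) => c0; lra.
Qed.

Lemma brun_prod_bool_ge0 (X : nat -> bool) Bs : 0 <= brun_prod (fun p => (X p)%:R) Bs.
Proof. by apply: prodr_ge0 => B _; apply: brun_bool_ge0. Qed.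

Lemma brun_defect_bool_ge0 (X : nat -> bool) Bs :
  0 <= brun_defect (fun p => (X p)%:R) Bs.
Proof.
elim: Bs => //= B Bs IH; rewrite addr_ge0 // mulr_ge0 ?esym2_bool_ge0 ?brun_bool_ge0 //.
exact: brun_prod_bool_ge0.
Qed.

(** The summand of a block containing an event differs from the product only in the factor of that
    block, which has grown; all other summands are non-negative. *)
Lemma brun_prod_le_defect (X : nat -> bool) Bs : has X (flatten Bs) ->
  brun_prod (fun p => (X p)%:R) Bs <= brun_defect (fun p => (X p)%:R) Bs.
Proof.
elim: Bs => //= B Bs IH; rewrite has_cat brun_prod_cons => /orP[XB|/IH H].
  rewrite -[leLHS]addr0 lerD ?mulr_ge0 ?brun_bool_ge0 ?brun_defect_bool_ge0 //.
  by rewrite ler_wpM2r ?brun_prod_bool_ge0 ?brun_bool_le_esym2.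
rewrite -[leLHS]add0r lerD ?mulr_ge0 ?esym2_bool_ge0 ?brun_prod_bool_ge0 //.
by rewrite ler_wpM2l ?brun_bool_ge0.
Qed.

Lemma brun_prod_ge0 v Bs : {in flatten Bs, forall p, 0 <= v p} ->
  {in Bs, forall B, esym1 v B <= 1 / 2} -> 0 <= brun_prod v Bs.
Proof.
move=> v0 h; rewrite /brun_prod big_seq prodr_ge0 // => B BBs.
have vB : {in B, forall p, 0 <= v p}.
  by move=> p pB; apply: v0; apply/flattenP; exists B.
by have /andP[l _] := brun_bounds vB (h _ BBs); apply: le_trans l; lra.
Qed.

(** In each block [esym2 <= esym1 ^+ 2 / 2 <= brun * esym1 ^+ 2], because [brun >= 1 / 2]. *)
Lemma brun_defect_le v Bs : {in flatten Bs, forall p, 0 <= v p} ->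
  {in Bs, forall B, esym1 v B <= 1 / 2} ->
  brun_defect v Bs <= brun_prod v Bs * \sum_(B <- Bs) esym1 v B ^+ 2.
Proof.
elim: Bs => [|B Bs IH] v0 h; first by rewrite big_nil mulr0.
have vB : {in B, forall p, 0 <= v p}.
  by move=> p pB; apply: v0; rewrite mem_cat pB.
have vBs : {in flatten Bs, forall p, 0 <= v p}.
  by move=> p pB; apply: v0; rewrite mem_cat pB orbT.
have hBs : {in Bs, forall B, esym1 v B <= 1 / 2}.
  by move=> C CB; apply: h; rewrite in_cons CB orbT.
have /andP[l _] := brun_bounds vB (h _ (mem_head _ _)).
have /andP[f0 f1] := esym2_bounds vB.
have w0 := brun_prod_ge0 vBs hBs.
rewrite brun_prod_cons big_cons /= mulrDr lerD //.
  rewrite mulrAC ler_wpM2r // (le_trans f1) // mulrC.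
  by apply: ler_wpM2r; rewrite ?sqr_ge0 //; lra.
rewrite -mulrA ler_wpM2l ?IH //; by apply: le_trans l; lra.
Qed.

(** A block that loses no prime keeps its factor. In any other block the factor was at least 1/2 and
    becomes at most 1, so it at most doubles, and at least one removed prime pays for this. *)
Lemma brun_prod_filter_le v Bs (a : pred nat) : {in flatten Bs, forall p, 0 <= v p} ->
  {in Bs, forall B, esym1 v B <= 1 / 2} ->
  brun_prod v (map (filter a) Bs) <=
    2 ^+ count (predC a) (flatten Bs) * brun_prod v Bs.
Proof.
elim: Bs => [|B Bs IH] v0 h; first by rewrite /= expr0 mul1r.
have vB : {in B, forall p, 0 <= v p}.
  by move=> p pB; apply: v0; rewrite mem_cat pB.
have vBs : {in flatten Bs, forall p, 0 <= v p}.
  by move=> p pB; apply: v0; rewrite mem_cat pB orbT.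
have hBs : {in Bs, forall B, esym1 v B <= 1 / 2}.
  by move=> C CB; apply: h; rewrite in_cons CB orbT.
have /andP[l _] := brun_bounds vB (h _ (mem_head _ _)).
have vfB : {in filter a B, forall p, 0 <= v p}.
  by move=> p; rewrite mem_filter => /andP[_ /vB].
have hf : esym1 v (filter a B) <= 1 / 2.
  apply: le_trans (h _ (mem_head _ _)); rewrite /esym1 big_filter big_mkcond !big_seq.
  by apply: ler_sum => p pB; case: ifP => // _; apply: vB.
have /andP[lf uf] := brun_bounds vfB hf.
have w0 : 0 <= brun_prod v (map (filter a) Bs).
  rewrite brun_prod_ge0 // => [p /flattenP[_ /mapP[C CBs ->]]|_ /mapP[C CBs ->]].
    by rewrite mem_filter => /andP[_ pC]; apply: vBs; apply/flattenP; exists C.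
  apply: le_trans (hBs _ CBs); rewrite /esym1 big_filter big_mkcond !big_seq.
  apply: ler_sum => p pB; case: ifP => // _; apply: vBs; apply/flattenP; exists C => //.
rewrite /= !brun_prod_cons count_cat exprD mulrACA.
apply: ler_pM; rewrite ?IH //; first by apply: le_trans lf; lra.
have [c0|c1] := posnP (count (predC a) B).
  rewrite c0 expr0 mul1r (_ : filter a B = B) //; apply/all_filterP.
  by rewrite -[all _ _]negbK -has_predC has_count c0.
apply: le_trans uf _; apply: le_trans (_ : 2 * brun v B <= _); first lra.
rewrite ler_wpM2r //; first by apply: le_trans l; lra.
by rewrite -{1}[2]expr1 ler_weXn2l ?ler1n.
Qed.

Lemma cong_poly_size_ge0 P f mu sigma : cong_poly P f mu sigma -> 0 <= sigma.
Proof. by move=> [s [_ _ H _]]; apply: le_trans H; rewrite sumr_ge0. Qed.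

Section BrunCongPoly.

(** [X p m] is the event attached to the prime [p], [h p] is its density in [m], and [c p] bounds
    the [l^1] norm of its expansion into residue classes. *)
Variables (X : nat -> nat -> bool) (h c : nat -> QQ).

Let Xm (m : nat) : nat -> QQ := fun p => (X p m)%:R.

Let event p := cong_poly (pred1 p) (fun m => Xm m p) (h p) (c p).

Lemma cong_poly_esym1 B : {in B, forall p, event p} ->
  cong_poly [pred p in B] (fun m => esym1 (Xm m) B) (esym1 h B) (esym1 c B).
Proof.
elim: B => [|p B IH] H.
  rewrite /esym1 !big_nil -[X in cong_poly _ _ _ X](@normr0 _ QQ); apply: cong_poly_ext (cong_poly_const _ _).
  by move=> m; rewrite big_nil.
rewrite !esym1_cons.
apply: (@cong_poly_ext _ (fun m => Xm m p + esym1 (Xm m) B)) => [m|].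
  by rewrite esym1_cons.
apply: cong_polyD.
  by apply: cong_poly_sub (H p (mem_head _ _)) => q; rewrite !inE => ->.
apply: cong_poly_sub (IH _) => q; first by rewrite !inE => ->; rewrite orbT.
by move=> qB; apply: H; rewrite in_cons qB orbT.
Qed.

Lemma cong_poly_esym2 B : uniq B -> {in B, forall p, event p} ->
  cong_poly [pred p in B] (fun m => esym2 (Xm m) B) (esym2 h B) (esym1 c B ^+ 2).
Proof.
elim: B => [|p B IH] /= uB H.
  by rewrite /esym1 big_nil expr0n -[X in cong_poly _ _ _ X](@normr0 _ QQ); apply: cong_poly_const.
case/andP: uB => pB uB.
have HB : {in B, forall p, event p} by move=> q qB; apply: H; rewrite in_cons qB orbT.
have Hp := H p (mem_head _ _); have c0 := cong_poly_size_ge0 Hp.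
have e0 := cong_poly_size_ge0 (cong_poly_esym1 HB).
apply: (@cong_poly_le _ _ _ (esym1 c B ^+ 2 + c p * esym1 c B)).
  by rewrite esym1_cons; move: (c p) (esym1 c B) c0 e0 => x y x0 y0; nra.
apply: cong_polyD.
  by apply: cong_poly_sub (IH uB HB) => q; rewrite !inE => ->; rewrite orbT.
apply: cong_poly_sub (cong_polyM _ Hp (cong_poly_esym1 HB)) => q.
  by rewrite !inE.
by rewrite !inE => /eqP ->; rewrite (negbTE pB).
Qed.

(** One multiplicative bound for the [l^1] norms of both [brun] and [esym2], which are at most
    [1 + e + e ^+ 2] and [e ^+ 2] for [e = esym1 c B]. *)
Definition brun_size (B : seq nat) : QQ := (1 + esym1 c B) ^+ 2.

Lemma cong_poly_brun B : uniq B -> {in B, forall p, event p} ->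
  cong_poly [pred p in B] (fun m => brun (Xm m) B) (brun h B) (brun_size B).
Proof.
move=> uB H; have H1 := cong_poly_esym1 H; have H2 := cong_poly_esym2 uB H.
have e0 := cong_poly_size_ge0 H1.
apply: (@cong_poly_le _ _ _ (1 + esym1 c B + esym1 c B ^+ 2)).
  by rewrite /brun_size; move: (esym1 c B) e0 => x x0; nra.
apply: cong_polyD H2.
have := cong_polyD (cong_poly_const [pred p in B] 1) (cong_polyZ (-1) H1).
rewrite normrN1 normr1 !mul1r mulN1r; apply: cong_poly_ext => m.
by rewrite mulN1r.
Qed.

Lemma cong_poly_esym2_brun_size B : uniq B -> {in B, forall p, event p} ->
  cong_poly [pred p in B] (fun m => esym2 (Xm m) B) (esym2 h B) (brun_size B).
Proof.
move=> uB H; apply: cong_poly_le (cong_poly_esym2 uB H).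
have e0 := cong_poly_size_ge0 (cong_poly_esym1 H).
by rewrite /brun_size; move: (esym1 c B) e0 => x x0; nra.
Qed.

Definition brun_prod_size (Bs : seq (seq nat)) : QQ := \prod_(B <- Bs) brun_size B.

Lemma cong_poly_brun_prod Bs : uniq (flatten Bs) -> {in flatten Bs, forall p, event p} ->
  cong_poly [pred p in flatten Bs] (fun m => brun_prod (Xm m) Bs)
    (brun_prod h Bs) (brun_prod_size Bs).
Proof.
elim: Bs => [|B Bs IH] /= uB H.
  rewrite /brun_prod /brun_prod_size !big_nil -[X in cong_poly _ _ _ X](@normr1 QQ).
  by apply: cong_poly_ext (cong_poly_const _ _) => m; rewrite big_nil.
move: uB; rewrite cat_uniq => /and3P[uB /hasPn dB uBs].
rewrite brun_prod_cons /brun_prod_size big_cons.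
apply: (@cong_poly_ext _ (fun m => brun (Xm m) B * brun_prod (Xm m) Bs)) => [m|].
  by rewrite brun_prod_cons.
have HB : {in B, forall p, event p} by move=> q qB; apply: H; rewrite mem_cat qB.
have HBs : {in flatten Bs, forall p, event p} by move=> q qB; apply: H; rewrite mem_cat qB orbT.
apply: cong_poly_sub (cong_polyM _ (cong_poly_brun uB HB) (IH uBs HBs)) => q.
  by rewrite !inE mem_cat.
by rewrite !inE => qB /dB; rewrite qB.
Qed.

Lemma cong_poly_brun_defect Bs : uniq (flatten Bs) -> {in flatten Bs, forall p, event p} ->
  cong_poly [pred p in flatten Bs] (fun m => brun_defect (Xm m) Bs)
    (brun_defect h Bs) ((size Bs)%:R * brun_prod_size Bs).
Proof.
elim: Bs => [|B Bs IH] /= uB H.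
  by rewrite mul0r -[X in cong_poly _ _ _ X](@normr0 _ QQ); apply: cong_poly_const.
move: uB; rewrite cat_uniq => /and3P[uB /hasPn dB uBs].
rewrite /brun_prod_size big_cons.
have HB : {in B, forall p, event p} by move=> q qB; apply: H; rewrite mem_cat qB.
have HBs : {in flatten Bs, forall p, event p} by move=> q qB; apply: H; rewrite mem_cat qB orbT.
have dis p : p \in [pred p in B] -> p \in [pred p in flatten Bs] -> false.
  by rewrite !inE => qB /dB; rewrite qB.
rewrite -/(brun_prod_size Bs).
have -> : (size Bs).+1%:R * (brun_size B * brun_prod_size Bs) =
    brun_size B * brun_prod_size Bs + brun_size B * ((size Bs)%:R * brun_prod_size Bs).
  by rewrite -natr1; ring.
apply: cong_polyD.
  apply: cong_poly_sub (cong_polyM dis (cong_poly_esym2_brun_size uB HB)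
    (cong_poly_brun_prod uBs HBs)) => q.
  by rewrite !inE mem_cat.
apply: cong_poly_sub (cong_polyM dis (cong_poly_brun uB HB) (IH uBs HBs)) => q.
by rewrite !inE mem_cat.
Qed.

Lemma brun_prod_size_filter Bs (a : pred nat) : {in flatten Bs, forall p, 0 <= c p} ->
  brun_prod_size (map (filter a) Bs) <= brun_prod_size Bs.
Proof.
move=> c0; rewrite /brun_prod_size big_map !big_seq; apply: ler_prod => B BBs.
have cB : {in B, forall p, 0 <= c p}.
  by move=> p pB; apply: c0; apply/flattenP; exists B.
have l : esym1 c (filter a B) <= esym1 c B.
  rewrite /esym1 big_filter big_mkcond !big_seq; apply: ler_sum => p pB.
  by case: ifP => // _; apply: cB.
have e0 : 0 <= esym1 c (filter a B).
  by apply: esym1_ge0 => p; rewrite mem_filter => /andP[_ /cB].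
rewrite /brun_size; move: (esym1 c _) (esym1 c _) l e0 => x y l e0.
by apply/andP; split; nra.
Qed.

(* On [m = a %[mod d]] no event [X p] with [p %| d] occurs, so the primes of [d] may be
   deleted from the blocks, which makes the two congruence conditions independent. *)
Lemma cong_poly_brun_prod_cong Bs d a : uniq (flatten Bs) ->
  {in flatten Bs, forall p, event p} -> (0 < d)%N ->
  (forall m p, m = a %[mod d] -> p \in flatten Bs -> (p %| d)%N -> ~~ X p m) ->
  exists P : nat_pred, cong_poly P
    (fun m => brun_prod (Xm m) Bs * (m == a %[mod d])%:R)
    (brun_prod h (map (filter (fun p => ~~ (p %| d)%N)) Bs) / d%:R)
    (brun_prod_size Bs).
Proof.
move=> uB H d0 HX; set nd := fun p => ~~ (p %| d)%N.
have fE : flatten (map (filter nd) Bs) = filter nd (flatten Bs) by rewrite filter_flatten.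
have H' : {in flatten (map (filter nd) Bs), forall p, event p}.
  by move=> p; rewrite fE mem_filter => /andP[_ /H].
have uB' : uniq (flatten (map (filter nd) Bs)) by rewrite fE filter_uniq.
exists [predU [pred p in flatten (map (filter nd) Bs)] & \pi(d)].
apply: (@cong_poly_ext _ (fun m => brun_prod (Xm m) (map (filter nd) Bs) * (m == a %[mod d])%:R)).
  move=> m; case: eqP => [ma|]; last by rewrite !mulr0.
  congr (_ * _); rewrite /brun_prod big_map !big_seq; apply: eq_bigr => B BBs.
  rewrite /brun; have Z : {in B, forall p, ~~ nd p -> Xm m p = 0}.
    move=> p pB; rewrite negbK => pd; apply/eqP; rewrite pnatr_eq0 eqb0.
    by apply: HX ma _ pd; apply/flattenP; exists B.
  by rewrite esym1_filter // esym2_filter.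
apply: cong_poly_le (_ : brun_prod_size (map (filter nd) Bs) * 1 <= _) _.
  rewrite mulr1 brun_prod_size_filter // => p pB; exact: cong_poly_size_ge0 (H p pB).
apply: cong_polyM (cong_poly_brun_prod uB' H') (cong_poly_cong _ (pnat_pi d0)) => p.
rewrite inE fE mem_filter => /andP[npd _].
by rewrite mem_primes => /and3P[_ _ pd]; rewrite /nd pd in npd.
Qed.

End BrunCongPoly.

(** * Products of primes of medium size *)

(** Elements are added to the current block until its sum reaches [eta], and then a new block is
    opened. Closed blocks have sum at least [eta], which bounds their number; the last addition
    overshoots by at most [eta]. *)
Lemma greedy_blocks (v : nat -> QQ) (s : seq nat) (eta : QQ) : 0 <= eta ->
  {in s, forall p, 0 <= v p <= eta} ->
  exists Bs : seq (seq nat), [/\ flatten Bs = s,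
    {in Bs, forall B, esym1 v B <= 2 * eta} &
    (size Bs)%:R * eta <= esym1 v s + eta].
Proof.
move=> eta0 vs.
(* [B] is the block still open, [Bs] are the closed ones. *)
suff [B [Bs [sE H1 H2]]] : exists B Bs, [/\ B ++ flatten Bs = s,
    {in B :: Bs, forall B, esym1 v B <= 2 * eta} &
    (size Bs)%:R * eta <= esym1 v (flatten Bs)].
  exists (B :: Bs); split=> //=; rewrite -natr1 mulrDl mul1r lerD2r.
  apply: le_trans H2 _; rewrite -sE /esym1 big_cat /= lerDr.
  by apply: esym1_ge0 => p pB; have /vs/andP[] : p \in s by rewrite -sE mem_cat pB.
elim: s vs => [|p s IH] vs.
  exists [::], [::]; split; rewrite /esym1 ?big_nil ?mul0r //= => B.
  by rewrite inE => /eqP ->; rewrite big_nil mulr_ge0.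
have [|B [Bs [sE H1 H2]]] := IH; first by move=> q qs; apply: vs; rewrite in_cons qs orbT.
have /andP[p0 p1] := vs p (mem_head _ _).
have [lt|ge] := ltP (esym1 v B) eta.
  exists (p :: B), Bs; split=> //=; first by rewrite sE.
  move=> C; rewrite in_cons => /orP[/eqP ->|CBs].
    by rewrite esym1_cons; lra.
  by apply: H1; rewrite in_cons CBs orbT.
exists [:: p], (B :: Bs); split=> //=; first by rewrite sE.
  move=> C; rewrite in_cons => /orP[/eqP ->|/H1 //].
  by rewrite /esym1 big_seq1; lra.
rewrite -natr1 mulrDl mul1r /esym1 big_cat /= addrC.
exact: lerD.
Qed.

Lemma prod_1sub_ge (v : nat -> QQ) s : {in s, forall p, 0 <= v p <= 1} ->
  1 - esym1 v s <= \prod_(p <- s) (1 - v p) <= 1.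
Proof.
elim: s => [|p s IH] vs; first by rewrite /esym1 !big_nil subr0 lexx.
rewrite esym1_cons big_cons.
have vs' : {in s, forall p, 0 <= v p <= 1} by move=> q qs; apply: vs; rewrite in_cons qs orbT.
have /andP[p0 p1] := vs p (mem_head _ _); have /andP[l u] := IH vs'.
have e0 : 0 <= \prod_(p <- s) (1 - v p).
  by rewrite big_seq prodr_ge0 // => q /vs'; lra.
move: (v p) (esym1 v s) (\prod_(_ <- _) _) l u p0 p1 e0 => x e y l u p0 p1 e0.
by apply/andP; split; nra.
Qed.

(** Cutting greedily with [eta = 1 / 4] gives at most [4 * S + 1] blocks of sum at most 1/2, and the
    product over each block is at least 1/2. *)
Lemma prod_1sub_ge_exp2 (v : nat -> QQ) s (S : nat) : {in s, forall p, 0 <= v p <= 1 / 4} ->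
  esym1 v s <= S%:R -> 2 ^- (4 * S + 1) <= \prod_(p <- s) (1 - v p).
Proof.
move=> vs vS; have [|Bs [sE HB szB]] := greedy_blocks _ vs; first lra.
have szle : (size Bs <= 4 * S + 1)%N.
  by rewrite -(ler_nat QQ) natrD natrM; lra.
apply: le_trans (_ : 2 ^- size Bs <= _).
  by rewrite lef_pV2 ?posrE ?exprn_gt0 ?ltr0n // ler_weXn2l ?ler1n.
rewrite -sE big_flatten /= -exprVn.
have : {in Bs, forall B, 2^-1 <= \prod_(p <- B) (1 - v p)}.
  move=> B BBs; have vB : {in B, forall p, 0 <= v p <= 1}.
    move=> p pB; have /vs : p \in s by rewrite -sE; apply/flattenP; exists B.
    lra.
  have /andP[l _] := prod_1sub_ge vB.
  by apply: le_trans l; have := HB _ BBs; lra.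
elim: Bs {sE HB szB szle} => [|B Bs IH] H; first by rewrite big_nil.
rewrite big_cons exprS ler_pM ?exprn_ge0 ?invr_ge0 ?H ?mem_head //.
by apply: IH => C CB; apply: H; rewrite in_cons CB orbT.
Qed.

(* The products of [t] elements of [ps], repetitions allowed. *)
Fixpoint multiset_prods (ps : seq nat) : nat -> seq nat :=
  if ps is p :: ps' then
    fix loop t := if t is t'.+1 then multiset_prods ps' t ++ map (muln p) (loop t') else [:: 1%N]
  else fun t => if t is _.+1 then [::] else [:: 1%N].

Lemma multiset_prods0 ps : multiset_prods ps 0 = [:: 1%N].
Proof. by case: ps. Qed.

Lemma multiset_prodsS p ps t : multiset_prods (p :: ps) t.+1 =
  multiset_prods ps t.+1 ++ map (muln p) (multiset_prods (p :: ps) t).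
Proof. by []. Qed.

(* Rankin's trick with parameter [v]. *)
Lemma sum_inv_multiset_prods (v : QQ) ps t : 0 < v -> {in ps, forall p, v < p%:R} ->
  \sum_(d <- multiset_prods ps t) d%:R^-1 <= v ^- t * (\prod_(p <- ps) (1 - v / p%:R))^-1.
Proof.
move=> v0; elim: ps t => [|p ps IHps].
  by case=> [|t] H; rewrite ?big_seq1 !big_nil !(invr1, mulr1) // invr_ge0 exprn_ge0 // ltW.
move=> t H; have Hps : {in ps, forall p, v < p%:R} by move=> q qs; apply: H; rewrite in_cons qs orbT.
have vp := H p (mem_head _ _); have p0 := lt_trans v0 vp.
have P0 : 0 < \prod_(p <- ps) (1 - v / p%:R).
  rewrite big_seq prodr_gt0 // => q /Hps vq.
  by rewrite subr_gt0 ltr_pdivrMr ?mul1r // (lt_trans v0).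
have a0 : 0 < v / p%:R by rewrite divr_gt0.
have a1 : 0 < 1 - v / p%:R by rewrite subr_gt0 ltr_pdivrMr ?mul1r.
rewrite big_cons invfM.
elim: t => [|t IHt].
  rewrite multiset_prods0 big_seq1 expr0 invr1 mul1r -invfM invf_ge1 ?mulr_gt0 //.
  have v01 : {in ps, forall q, 0 <= v / q%:R <= 1}.
    move=> q /Hps vq; have q0 := lt_trans v0 vq.
    by rewrite divr_ge0 ?(ltW v0) ?(ltW q0) //= ler_pdivrMr // mul1r ltW.
  have /andP[_ u] := prod_1sub_ge v01.
  by apply: mulr_ile1 => //; lra.
rewrite multiset_prodsS big_cat big_map /=.
rewrite [X in _ + X](eq_bigr (fun d => p%:R^-1 * d%:R^-1)) => [|d _]; last by rewrite natrM invfM.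
rewrite -mulr_sumr.
apply: le_trans (lerD (IHps t.+1 Hps) (ler_wpM2l _ IHt)) _; first by rewrite invr_ge0 ltW.
rewrite exprS invfM; move: P0; set P := \prod_(_ <- _) _ => P0.
move: a1; have : v ^+ t != 0 by rewrite expf_neq0 ?gt_eqF.
move: (v ^+ t) => w w0 a1.
(* With [x = v / p] this is the identity [1 + x / (1 - x) = 1 / (1 - x)], up to common factors. *)
rewrite le_eqVlt; apply/orP; left; apply/eqP.
have pv : p%:R - v != 0 by rewrite subr_eq0 gt_eqF.
by field; rewrite (gt_eqF v0) (gt_eqF p0) w0 (gt_eqF P0) pv.
Qed.

Lemma size_multiset_prods ps t : (size (multiset_prods ps t) <= size ps ^ t)%N.
Proof.
elim: ps t => [|p ps IHps]; first by case.
elim=> [|t IHt]; first by rewrite multiset_prods0.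
rewrite multiset_prodsS size_cat size_map (leq_trans (leq_add (IHps _) IHt)) //=.
have := @leq_exp2r (size ps) (size ps).+1 t.
case: t {IHt} => [|t]; first by rewrite !expn1 expn0; lia.
move=> /(_ isT); rewrite leqnSn => H; rewrite expnS [leqRHS]expnS mulSn addnC leq_add2l leq_mul2l H orbT //.
Qed.

(** If the first prime divides [n], it is split off and [t] decreases; otherwise it contributes
    nothing and is dropped from the list. *)
Lemma multiset_prods_dvd ps t n : uniq ps -> all prime ps -> (0 < n)%N ->
  (t <= \sum_(p <- ps) logn p n)%N -> exists2 d, d \in multiset_prods ps t & (d %| n)%N.
Proof.
elim: ps t n => [|p ps IHps].
  by case=> [|t] n _ _ _; [exists 1%N | rewrite big_nil].
move=> t n /= /andP[pps ups] /andP[pp aps]; elim: t n => [|t IHt] n n0; first by exists 1%N.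
rewrite big_cons => H; have [pn|pn] := boolP (p %| n)%N; last first.
  have [|d d1 d2] := IHps t.+1 n ups aps n0.
    by move: H; rewrite lognE n0 (negbTE pn) pp.
  by exists d => //; rewrite mem_cat d1.
case/dvdnP: pn => m nE; have m0 : (0 < m)%N by case: m nE n0 => // ->.
have [|d d1 d2] := IHt m m0.
  rewrite big_cons.
  have E : (\sum_(q <- ps) logn q n = \sum_(q <- ps) logn q m)%N.
    apply: eq_big_seq => q qs; rewrite nE lognM ?(prime_gt0 pp) //.
    rewrite (logn_prime _ pp) (_ : (q == p) = false) ?addn0 //.
    by apply: contraNF pps => /eqP <-.
  by move: H; rewrite E nE lognM ?(prime_gt0 pp) // (logn_prime _ pp) eqxx addn1 addSn ltnS.
exists (p * d)%N; last by rewrite nE mulnC dvdn_pmul2r ?prime_gt0.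
by rewrite mem_cat (map_f (muln p) d1) orbT.
Qed.

Lemma multiset_prods_prime_dvd ps t d p : all prime ps -> d \in multiset_prods ps t ->
  prime p -> (p %| d)%N -> p \in ps.
Proof.
elim: ps t d => [|q ps IHps].
  by case=> [|t] d _ //; rewrite inE => /eqP -> pp; rewrite dvdn1 => /eqP p1; rewrite p1 in pp.
move=> t d aps; have /andP[pq aps'] := aps; elim: t d => [|t IHt] d.
  by rewrite multiset_prods0 inE => /eqP -> pp; rewrite dvdn1 => /eqP p1; rewrite p1 in pp.
rewrite multiset_prodsS mem_cat => /orP[d1|/mapP[e e1 ->]] pp.
  by move=> pd; rewrite in_cons (IHps _ _ aps' d1 pp pd) orbT.
rewrite Euclid_dvdM // => /orP[|pe]; last exact: IHt e1 pp pe.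
by rewrite dvdn_prime2 // => /eqP ->; rewrite mem_head.
Qed.

Lemma multiset_prods_gt0 ps t d : all prime ps -> d \in multiset_prods ps t -> (0 < d)%N.
Proof.
elim: ps t d => [|q ps IHps].
  by case=> [|t] d _ //; rewrite inE => /eqP ->.
move=> t d aps; have /andP[pq aps'] := aps; elim: t d => [|t IHt] d.
  by rewrite multiset_prods0 inE => /eqP ->.
rewrite multiset_prodsS mem_cat => /orP[|/mapP[e e1 ->]]; first exact: IHps.
by rewrite muln_gt0 prime_gt0 // IHt.
Qed.

(** Limits to [2 ^ t] the loss in [brun_prod_filter_le] when the primes of [d] are deleted from the
    blocks. *)
Lemma multiset_prods_count ps t d B : uniq B -> all prime B -> all prime ps ->
  d \in multiset_prods ps t -> (count (fun p => p %| d)%N B <= t)%N.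
Proof.
move=> uB pB; have C1 : count (fun p => p %| 1)%N B = 0%N.
  apply/eqP; rewrite -leqn0 leqNgt -has_count; apply/hasPn => p /(allP pB) pp.
  by rewrite dvdn1; apply: contraL pp => /eqP ->.
elim: ps t d => [|q ps IHps].
  by case=> [|t] d _ //; rewrite inE => /eqP ->; rewrite C1.
move=> t d aps; have /andP[pq aps'] := aps; elim: t d => [|t IHt] d.
  by rewrite multiset_prods0 inE => /eqP ->; rewrite C1.
rewrite multiset_prodsS mem_cat => /orP[|/mapP[e e1 ->]]; first exact: IHps.
apply: leq_trans (_ : count (pred1 q) B + count (fun p => p %| e)%N B <= _)%N.
  rewrite -count_predUI; apply: leq_trans (leq_addr _ _).
  elim: B pB {uB C1 IHps IHt} => //= p B IH /andP[pp /IH H].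
  apply: leq_add; last exact: H.
  by rewrite Euclid_dvdM // dvdn_prime2.
by rewrite -add1n leq_add ?IHt // count_uniq_mem // leq_b1.
Qed.

(** * The sieve *)

(* The pairs [(d, a)] of [E] are the residue classes to be avoided because they make a
   shift divisible by too large a smooth number. *)
Lemma sieve_exists (X : nat -> nat -> bool) (h c : nat -> QQ) (Bs : seq (seq nat))
    (E : seq (nat * nat)) (M : nat) :
  uniq (flatten Bs) -> all prime (flatten Bs) ->
  {in flatten Bs, forall p, cong_poly (pred1 p) (fun m => (X p m)%:R) (h p) (c p)} ->
  {in flatten Bs, forall p, 0 <= h p} ->
  {in Bs, forall B, esym1 h B <= 1 / 2} ->
  \sum_(B <- Bs) esym1 h B ^+ 2 <= 1 / 4 ->
  {in E, forall e, (0 < e.1)%N /\ forall m p, m = e.2 %[mod e.1] ->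
     p \in flatten Bs -> (p %| e.1)%N -> ~~ X p m} ->
  \sum_(e <- E) 2 ^+ count (fun p => p %| e.1)%N (flatten Bs) / e.1%:R <= 1 / 4 :> QQ ->
  (1 + size Bs + size E)%:R * brun_prod_size c Bs < M%:R * brun_prod h Bs / 2 ->
  exists m, [/\ (m < M)%N, {in flatten Bs, forall p, ~~ X p m} &
    {in E, forall e, m != e.2 %[mod e.1]}].
Proof.
move=> uB pB ev h0 hB sB HE sE szM.
set Xm := fun m p => (X p m)%:R : QQ.
set good := fun m : nat => ~~ has (X^~ m) (flatten Bs) &&
  ~~ has (fun e => m == e.2 %[mod e.1])%N E.
have [/hasP[m]|/hasPn none] := boolP (has good (iota 0 M)).
  rewrite mem_iota add0n => mM /andP[/hasPn g1 /hasPn g2]; exists m; split=> //.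
set mu := brun_prod h Bs; set sg := brun_prod_size c Bs; move: szM; rewrite -/mu -/sg => szM.
have mu0 : 0 <= mu by apply: brun_prod_ge0.
pose g m := \sum_(e <- E) brun_prod (Xm m) Bs * (m == e.2 %[mod e.1])%:R.
(* If no [m] is good, the weight is everywhere bounded by its defect plus [g], its part on the
   classes of [E]. Averaging over [m < M] will contradict this. *)
have pw m : (m < M)%N -> brun_prod (Xm m) Bs <= brun_defect (Xm m) Bs + g m.
  move=> mM; have := none m; rewrite mem_iota mM => /(_ isT).
  have g0 : 0 <= g m by apply: sumr_ge0 => e _; rewrite mulr_ge0 ?brun_prod_bool_ge0.
  rewrite negb_and !negbK => /orP[H|/hasP[e eE me]].
    by rewrite -[leLHS]addr0 lerD // brun_prod_le_defect.
  rewrite -[leLHS]add0r lerD ?brun_defect_bool_ge0 // /g (big_rem _ eE) /= me mulr1 lerDl.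
  by apply: sumr_ge0 => e' _; rewrite mulr_ge0 ?brun_prod_bool_ge0.
have : \sum_(0 <= m < M) brun_prod (Xm m) Bs <=
       \sum_(0 <= m < M) brun_defect (Xm m) Bs + \sum_(0 <= m < M) g m.
  rewrite -big_split /= big_nat [leRHS]big_nat; apply: ler_sum => m /andP[_ mM].
  exact: pw.
have := cong_poly_sum M (cong_poly_brun_prod uB ev); rewrite ler_norml => /andP[S1 _].
have := cong_poly_sum M (cong_poly_brun_defect uB ev); rewrite ler_norml => /andP[_ S2].
(* On the class of [e] the weight has mean at most [mu * 2 ^ c / e.1], with [c] the number of block
   primes dividing [e.1], and error at most [sg]. *)
have S3 : \sum_(0 <= m < M) g m <= M%:R * mu * (1 / 4) + (size E)%:R * sg.
  rewrite exchange_big /=.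
  apply: le_trans (_ : \sum_(e <- E) (M%:R * mu *
      (2 ^+ count (fun p => p %| e.1)%N (flatten Bs) / e.1%:R) + sg) <= _).
    rewrite big_seq [leRHS]big_seq; apply: ler_sum => e eE.
    have [e0 eX] := HE e eE.
    have [P cP] := cong_poly_brun_prod_cong uB ev e0 eX.
    have := cong_poly_sum M cP; rewrite ler_norml => /andP[_ S].
    rewrite -lerBlDl in S *; apply: le_trans S.
    rewrite lerB // mulrA; apply: le_trans (_ : M%:R * (mu *
      2 ^+ count (fun p => p %| e.1)%N (flatten Bs)) / e.1%:R <= _); last by rewrite !mulrA.
    rewrite -!mulrA ler_wpM2l // !mulrA ler_wpM2r ?invr_ge0 //.
    rewrite mulrC (eq_count (a2 := predC (fun p => ~~ (p %| e.1)%N))) => [|p]; last first.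
      by rewrite /= negbK.
    exact: brun_prod_filter_le.
  rewrite big_split /= -mulr_sumr lerD //.
    by rewrite ler_wpM2l // mulr_ge0.
  by rewrite big_const_seq count_predT iter_addr_0 mulr_natl.
have D : brun_defect h Bs <= mu * (1 / 4).
  by apply: le_trans (brun_defect_le h0 hB) _; rewrite ler_wpM2l.
have {}D : M%:R * brun_defect h Bs <= M%:R * mu * (1 / 4).
  by rewrite -mulrA ler_wpM2l.
(* Defect and exceptional classes each take at most a quarter of [M * mu], and the errors total
   [(1 + size Bs + size E) * sg], less than the remaining half. *)
rewrite -/mu -/sg in S1 S2 S3 *.
move: szM; rewrite !natrD !mulrDl mul1r => szM S4.
move: S1 S2 S3 S4 D szM.
move: (\sum_(0 <= m < M) brun_prod _ _) (\sum_(0 <= m < M) brun_defect _ _)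
  (\sum_(0 <= m < M) g m) ((size E)%:R * sg) ((size Bs)%:R * sg) (M%:R * brun_defect h Bs) (M%:R * mu).
move=> a b e x y z w S1 S2 S3 S4 D szM; exfalso; lra.
Qed.

Local Open Scope nat_scope.

(** * Prime factors of shifts of a multiple of [multQ L] *)

(** For [i <= e.+1], [p ^ i] divides [n + k] exactly when it divides [k], and [p ^ e.+1] does not
    divide [k]. *)
Lemma logn_add_small p e n k : prime p -> 0 < k -> p ^ e.+1 %| n -> logn p k <= e ->
  logn p (n + k) = logn p k.
Proof.
move=> pp k0 pn ke; have nk0 : 0 < n + k by rewrite addn_gt0 k0 orbT.
have dvdE i : i <= e.+1 -> (i <= logn p (n + k)) = (i <= logn p k).
  move=> ie; rewrite -!pfactor_dvdn // dvdn_addr //.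
  by apply: dvdn_trans pn; apply: dvdn_exp2l.
by apply/eqP; rewrite eqn_leq dvdE ?leqW // leqnn andbT leqNgt dvdE // ltnn.
Qed.

Lemma prod_pfactor_dvd (s : seq nat) n : uniq s -> all prime s -> 0 < n ->
  \prod_(p <- s) p ^ logn p n %| n.
Proof.
move=> us ps n0; elim: s us ps => [|p s IH] /=; first by rewrite big_nil dvd1n.
move=> /andP[ps us] /andP[pp als]; rewrite big_cons Gauss_dvd ?pfactor_dvdnn ?IH //.
rewrite coprimeXl // prime_coprime // Euclid_dvd_prod // big_has.
apply/hasPn => q qs; rewrite Euclid_dvdX // dvdn_prime2 //; last exact: (allP als).
by apply/negP => /andP[/eqP pq _]; rewrite pq qs in ps.
Qed.

Lemma leq_expn m n e : m <= n -> m ^ e <= n ^ e.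
Proof. by case: e => // e mn; rewrite leq_exp2r. Qed.

(** Bounds the number of prime factors of size at least [M ^ (1 / e)], stated without roots: their
    product with multiplicity is at most [n], and both sides are raised to the power [e]. *)
Lemma logn_sum_bound (s : seq nat) n M e : uniq s -> all prime s -> 0 < n ->
  {in s, forall p, M <= p ^ e} -> M ^ (\sum_(p <- s) logn p n) <= n ^ e.
Proof.
move=> us ps n0 H.
apply: leq_trans (_ : (\prod_(p <- s) p ^ logn p n) ^ e <= _); last first.
  by rewrite leq_expn // dvdn_leq ?prod_pfactor_dvd.
elim: s H {us ps} => [|p s IH] H; first by rewrite !big_nil exp1n.
rewrite !big_cons expnD expnMn leq_mul //.
  by rewrite -expnM mulnC expnM leq_expn // H ?mem_head.
by apply: IH => q qs; apply: H; rewrite in_cons qs orbT.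
Qed.

Lemma Omega_exp2 n : 0 < n -> 2 ^ Omega n <= n.
Proof.
move=> n0; rewrite -[leqRHS]expn1 /Omega.
have ap : all prime (primes n) by apply/allP => p; rewrite mem_primes => /and3P[].
by apply: logn_sum_bound; rewrite ?primes_uniq // => p /(allP ap) /prime_gt1.
Qed.

Lemma omega_le_Omega n : omega n <= Omega n.
Proof.
rewrite /omega /Omega -sum1_size big_seq [leqRHS]big_seq; apply: leq_sum => p.
by rewrite logn_gt0.
Qed.

Lemma Omega_range n b : 0 < n -> n <= b ->
  Omega n = \sum_(p <- primes_in 0 b) logn p n.
Proof.
move=> n0 nb; rewrite (bigID (fun p => p \in primes n)) /= -big_filter.
rewrite [X in _ + X]big1 ?addn0 => [|p].
  apply: perm_big; apply: uniq_perm; rewrite ?primes_uniq ?(filter_uniq _ (primes_in_uniq _ _)) //.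
  move=> p; rewrite mem_filter mem_primes_in mem_primes.
  case pp: (prime p); rewrite //= n0 /= prime_gt0 //=.
  by case pn: (p %| n); rewrite //= (leq_trans (dvdn_leq n0 pn)).
by rewrite -logn_gt0 lt0n negbK => /eqP.
Qed.

Lemma OmegaM_prime p n : prime p -> 0 < n -> Omega (p * n) = (Omega n).+1.
Proof.
move=> pp n0; have p0 := prime_gt0 pp; have pn0 : 0 < p * n by rewrite muln_gt0 p0.
rewrite (Omega_range pn0 (leqnn _)) (@Omega_range n (p * n)) // ?leq_pmull //.
rewrite (eq_big_seq (fun q => logn q p + logn q n)) => [|q _]; last by rewrite lognM.
rewrite big_split /= -add1n; congr (_ + _).
rewrite (eq_big_seq (fun q => if q == p then 1 else 0)) => [|q].
  rewrite -big_mkcond sum1_count count_uniq_mem ?primes_in_uniq //.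
  by rewrite mem_primes_in pp p0 leq_pmulr.
by rewrite logn_prime // => _; case: eqP.
Qed.

(** With [n = p * m], a divisor of [n] either divides [m] or is [p] times a divisor of [m]. Hence
    removing one prime factor at most halves [tau]. *)
Lemma tau_le_Omega n : 0 < n -> tau n <= 2 ^ Omega n.
Proof.
elim/ltn_ind: n => n IH n0; have [n1|n1] := leqP n 1.
  by rewrite (_ : n = 1) ?expn_gt0 //; lia.
have pp := pdiv_prime n1; have /dvdnP[m nE] := pdiv_dvd n; move: pp nE.
set p := pdiv n => pp nE; have p1 := prime_gt1 pp; rewrite mulnC in nE.
have m0 : 0 < m by case: m nE n0 => // ->; rewrite muln0.
rewrite nE OmegaM_prime // expnS mul2n -addnn.
have mn : m < n by rewrite nE ltn_Pmull.
apply: leq_trans (leq_add (IH m mn m0) (IH m mn m0)).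
rewrite /tau -[X in _ <= _ + X](size_map (muln p)) -size_cat.
apply: uniq_leq_size; first exact: divisors_uniq.
move=> d; rewrite -dvdn_divisors ?muln_gt0 ?m0 ?(ltnW p1) // mem_cat -dvdn_divisors // => dpm.
have [pd|pd] := boolP (p %| d); last first.
  by rewrite -(Gauss_dvdr m (n := p)) ?dpm // coprime_sym prime_coprime.
case/dvdnP: pd => e dE; rewrite dE mulnC map_f ?orbT // -dvdn_divisors //.
by rewrite dE mulnC dvdn_pmul2l ?(ltnW p1) in dpm.
Qed.

Definition multQ (L : nat) : nat :=
  \prod_(p <- primes_in 0 L) p ^ (trunc_log p L).+1.

Lemma multQ_gt0 L : 0 < multQ L.
Proof.
rewrite /multQ big_seq prodn_cond_gt0 // => p; rewrite mem_primes_in => /and3P[pp _ _].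
by rewrite expn_gt0 prime_gt0.
Qed.

Lemma dvdn_multQ L p : prime p -> p <= L -> p ^ (trunc_log p L).+1 %| multQ L.
Proof.
move=> pp pL; have pin : p \in primes_in 0 L by rewrite mem_primes_in pp prime_gt0.
by rewrite /multQ (big_rem p pin) /= dvdn_mulr.
Qed.

Lemma coprime_multQ L p : prime p -> L < p -> coprime p (multQ L).
Proof.
move=> pp Lp; rewrite prime_coprime // /multQ Euclid_dvd_prod // big_has.
apply/hasPn => q; rewrite mem_primes_in => /and3P[qp _ qL].
by rewrite Euclid_dvdX // dvdn_prime2 // andbT; lia.
Qed.

(** Each prime power in the product is at most [L ^ 2 = 2 ^ (2 * r)], and by Chebyshev there are at
    most [6 * 2 ^ r / r] of them when [r > 0]. *)
Lemma multQ_leq r : multQ (2 ^ r) <= 2 ^ (12 * 2 ^ r).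
Proof.
have L0 : 0 < 2 ^ r by rewrite expn_gt0.
apply: leq_trans (_ : 2 ^ (2 * r * size (primes_in 0 (2 ^ r))) <= _); last first.
  by rewrite leq_exp2l //; have := size_primes_pow2 r; lia.
rewrite /multQ expnM [2 * r]mulnC.
have : {in primes_in 0 (2 ^ r), forall p, p ^ (trunc_log p (2 ^ r)).+1 <= 2 ^ (r * 2)}.
  move=> p; rewrite mem_primes_in => /and3P[pp _ pL].
  by rewrite expnM expnS expnS expn1 leq_mul // trunc_logP // prime_gt1.
elim: (primes_in _ _) => [|p s IH] H; first by rewrite big_nil.
rewrite big_cons /= [leqRHS]expnS leq_mul ?H ?mem_head //.
by apply: IH => q qs; apply: H; rewrite in_cons qs orbT.
Qed.

Lemma logn_multQ_add L m k p : prime p -> p <= L -> 0 < k -> k <= L ->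
  logn p (multQ L * m + k) = logn p k.
Proof.
move=> pp pL k0 kL; apply: (@logn_add_small _ (trunc_log p L)) => //.
  by rewrite dvdn_mulr // dvdn_multQ.
apply: trunc_log_max; first exact: prime_gt1.
by apply: leq_trans kL; apply: dvdn_leq => //; apply: pfactor_dvdnn.
Qed.

(* The solution of [Q * m.+1 + k = 0 %[mod d]] for [d] coprime to [Q]. *)
Definition resid (Q d k : nat) : nat := (egcdn Q d).1 * (d.-1 * k) + d.-1.

(** The Bezout coefficient [u] inverts [Q] modulo [d]. In [resid] the factor [d.-1] stands for [-1],
    and the summand [d.-1] offsets the successor in [m.+1]; so [(resid Q d k).+1] is [-u * k] modulo
    [d]. *)
Lemma resid_dvd Q d k m : 0 < Q -> 0 < d -> coprime d Q ->
  (d %| Q * m.+1 + k) = (m == resid Q d k %[mod d]).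
Proof.
move=> Q0 d0 cdQ; set a := resid Q d k.
have da : d %| Q * a.+1 + k.
  rewrite /a /resid; case: egcdnP => //= u v uE _.
  have g1 : gcdn Q d = 1 by rewrite gcdnC; apply/eqP.
  rewrite g1 in uE.
  have -> : Q * (u * (d.-1 * k) + d.-1).+1 + k = d * (v * (d.-1 * k) + Q + k).
    case: d d0 uE {cdQ g1 a} => // d _ /= uE.
    rewrite -addnS mulnDr mulnA [Q * u]mulnC uE; nia.
  exact: dvdn_mulr.
have [am|ma] := leqP a m.
  rewrite eqn_mod_dvd // -[RHS](Gauss_dvdr _ cdQ) mulnBr.
  have -> : Q * m.+1 + k = Q * a.+1 + k + (Q * m - Q * a).
    by have := leq_mul (leqnn Q) am; rewrite !mulnS; lia.
  by rewrite dvdn_addr.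
rewrite eq_sym eqn_mod_dvd ?(ltnW ma) // -[RHS](Gauss_dvdr _ cdQ) mulnBr.
have E : Q * a.+1 + k = Q * m.+1 + k + (Q * a - Q * m).
  by have := leq_mul (leqnn Q) (ltnW ma); rewrite !mulnS; lia.
by rewrite E in da; apply/idP/idP => H; rewrite ?(dvdn_addr _ H) ?(dvdn_addl _ H) in da *.
Qed.

Local Open Scope ring_scope.
(** * Blocks of sieving primes *)

(* [scale p = s] for [2 ^ 2 ^ s < p <= 2 ^ 2 ^ s.+1]. *)
Definition scale (p : nat) : nat := trunc_log 2 (trunc_log 2 p.-1).

Lemma leq_scale x p : (2 ^ 2 ^ x < p)%N -> (x <= scale p)%N.
Proof.
by move=> H; apply: trunc_log_max => //; apply: trunc_log_max => //; rewrite -ltnS prednK //; lia.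
Qed.

Lemma scale_ltn x p : (2 < p)%N -> (p <= 2 ^ 2 ^ x)%N -> (scale p < x)%N.
Proof.
move=> p2 H; rewrite -(ltn_exp2l (m := 2)) //.
have t1 : (0 < trunc_log 2 p.-1)%N by apply: trunc_log_max => //; lia.
apply: leq_ltn_trans (trunc_logP _ t1) _ => //.
rewrite -(ltn_exp2l (m := 2)) //; apply: leq_ltn_trans (trunc_logP _ _) _ => //; lia.
Qed.

(* For [p > 2], the number of [k >= 1] with [p <= 2 ^ 2 ^ (R - 20 - k)]. *)
Definition nclasses (R p : nat) : nat := R - 21 - scale p.

Definition density (R p : nat) : QQ := (nclasses R p)%:R / p%:R.

Lemma density_ge0 R p : 0 <= density R p. Proof. by rewrite divr_ge0. Qed.

Definition scale_primes (R s : nat) : seq nat :=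
  [seq p <- primes_in (2 ^ 2 ^ s) (2 ^ 2 ^ s.+1) | (2 ^ (R - 5) < p)%N].

Lemma nclasses_scale R s i p : (s + i = R - 21)%N -> (2 < p)%N ->
  p \in primes_in (2 ^ 2 ^ s) (2 ^ 2 ^ s.+1) -> nclasses R p = i.
Proof.
move=> si p2; rewrite mem_primes_in => /and3P[_ lo hi].
have := leq_scale lo; have := scale_ltn p2 hi; rewrite /nclasses; lia.
Qed.

Lemma size_mem_flatten (T : eqType) (Bs : seq (seq T)) B :
  B \in Bs -> (size B <= size (flatten Bs))%N.
Proof.
elim: Bs => //= C Bs IH; rewrite in_cons size_cat => /orP[/eqP ->|/IH]; first exact: leq_addr.
by move=> H; apply: leq_trans H (leq_addl _ _).
Qed.

(** At this scale [i] classes are sieved, so the total density is at most [2 * i]. Cutting at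
    [1 / D] gives at most [2 * i * D + 1] blocks, each of squared sum at most [4 / D ^+ 2]. [D] is
    chosen so that the resulting [8 * i / D], about [1 / (12 * i * (i + 1))], fits under a
    telescoping term. *)
Lemma scale_blocks R s i (D : QQ) : (6 < R)%N ->
  D = 96 * i%:R ^+ 2 * (i%:R + 1) -> i%:R * D <= (2 ^ (R - 5))%:R ->
  (s + i = R - 21)%N -> (0 < i)%N ->
  exists Bs, [/\ flatten Bs = scale_primes R s,
    {in Bs, forall B, esym1 (density R) B <= 1 / 2},
    \sum_(B <- Bs) esym1 (density R) B ^+ 2 <= 1 / 8 * (i%:R^-1 - i.+1%:R^-1),
    (size Bs <= 385 * i ^ 4)%N &
    brun_prod_size (fun p => (nclasses R p)%:R) Bs <= 2 ^+ (385 * i ^ 4 * 2 ^ (s + 3))].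
Proof.
move=> R6 + + si i0; set P := scale_primes R s.
have L32 : (2 < 2 ^ (R - 5))%N by rewrite -[X in (X < _)%N]expn1 ltn_exp2l //; lia.
have PE p : p \in P -> [/\ p \in primes_in (2 ^ 2 ^ s) (2 ^ 2 ^ s.+1),
    (2 ^ (R - 5) < p)%N & nclasses R p = i].
  rewrite mem_filter => /andP[Lp pin]; split=> //.
  by apply: nclasses_scale si _ pin; apply: ltn_trans Lp.
have i0' : 1 <= i%:R :> QQ by rewrite ler1n.
move=> DE RL.
have {}RL p : (2 ^ (R - 5) < p)%N -> i%:R * D <= p%:R.
  by move=> Lp; apply: le_trans RL _; rewrite ler_nat ltnW.
have Dge1 : 1 <= D by rewrite DE; move: (i%:R) i0' => x x1; nra.
have D0 : 0 < D by lra.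
have hP : {in P, forall p, 0 <= density R p <= D^-1}.
  move=> p /PE[_ Lp ci]; rewrite density_ge0 /= /density ci.
  have p0 : 0 < p%:R :> QQ by rewrite ltr0n; apply: leq_ltn_trans Lp.
  rewrite ler_pdivrMr // mulrC ler_pdivlMr //.
  exact: RL.
have SP : esym1 (density R) P <= 2 * i%:R.
  rewrite /esym1 (eq_big_seq (fun p => i%:R * p%:R^-1)) => [|p /PE[_ _ ci]]; last first.
    by rewrite /density ci.
  rewrite -mulr_sumr mulrC ler_wpM2r //; apply: le_trans (sum_inv_primes_scale s).
  rewrite /P /scale_primes big_filter big_mkcond; apply: ler_sum => p _.
  by case: ifP => // _; rewrite invr_ge0.
have [|Bs [BsE B1 B2]] := greedy_blocks _ hP; first by rewrite invr_ge0 ltW.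
have szB : (size Bs)%:R <= 2 * i%:R * D + 1.
  have : (size Bs)%:R * D^-1 <= 2 * i%:R + D^-1 by lra.
  rewrite -(ler_pM2r D0) mulfVK ?gt_eqF // mulrDl mulVf ?gt_eqF //.
have DV1 : D^-1 <= 1 by rewrite invf_le1.
(* [2 * i * D + 1 = 192 * i ^ 4 + 192 * i ^ 3 + 1]. *)
have szB' : (size Bs <= 385 * i ^ 4)%N.
  rewrite -(ler_nat QQ) natrM natrX; apply: le_trans szB _; rewrite DE.
  by move: (i%:R) i0' => x x1; nra.
exists Bs; split=> //.
- move=> B /B1 H; apply: le_trans H _.
  have : D^-1 <= 1 / 4 ; last by lra.
  rewrite mul1r lef_pV2 ?posrE // DE.
  by move: (i%:R) i0' => x x1; nra.
- apply: le_trans (sum_const_le (c := (2 * D^-1) ^+ 2) _) _.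
    move=> B BBs; have pB : {in B, forall p, 0 <= density R p} by move=> p _; apply: density_ge0.
    rewrite ler_pXn2r ?nnegrE ?B1 ?esym1_ge0 //.
    by rewrite mulr_ge0 // invr_ge0 ltW.
  apply: le_trans (ler_wpM2r _ szB) _; first by rewrite sqr_ge0.
  rewrite -(natr1 i) DE; move: (i%:R) i0' => x x1.
  have x0 : 0 < x by lra. have x10 : 0 < x + 1 by lra.
  rewrite -subr_ge0.
  have -> : 1 / 8 * (x^-1 - (x + 1)^-1) -
      (2 * x * (96 * x ^+ 2 * (x + 1)) + 1) * (2 * (96 * x ^+ 2 * (x + 1))^-1) ^+ 2 =
    (96 * x ^+ 3 * (x+1) - 1) * 4 / (96 * x ^+ 2 * (x + 1)) ^+ 2.
    by field; rewrite !gt_eqF.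
  rewrite divr_ge0 ?sqr_ge0 // mulr_ge0 // subr_ge0.
  have x3 : 1 <= x ^+ 3 by rewrite exprn_ege1.
  nra.
(* A block has fewer than [Y] primes and [i <= Y], so its [brun_size] is at most
   [(Y ^ 2) ^ 2 = 2 ^ 2 ^ (s + 3)]. *)
- set Y := (2 ^ 2 ^ s.+1)%N.
  have Y0 : (0 < Y)%N by rewrite expn_gt0.
  have bB B : B \in Bs -> brun_size (fun p => (nclasses R p)%:R) B <= 2 ^+ (2 ^ (s + 3)).
    move=> BBs; have BP p : p \in B -> p \in P.
      by move=> pB; rewrite -BsE; apply/flattenP; exists B.
    rewrite /brun_size /esym1 (eq_big_seq (fun p => i%:R)) => [|p /BP/PE[_ _ ->] //].
    rewrite big_const_seq count_predT iter_addr_0 -mulrnA.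
    rewrite (_ : 1 + (i * size B)%:R = (i * size B).+1%:R); last by rewrite -natr1 addrC.
    have YE : (2 ^ 2 ^ (s + 3) = Y ^ 4)%N.
      by rewrite /Y -expnM addn3 !expnS; congr (_ ^ _)%N; lia.
    rewrite -!natrX ler_nat YE.
    case: B BBs BP => [|p B] BBs BP; first by rewrite muln0 exp1n expn_gt0 Y0.
    have [/[!mem_primes_in]/and3P[pp lo hi] Lp _] := PE p (BP p (mem_head _ _)).
    have ip : (i <= p)%N.
      rewrite -(ler_nat QQ); apply: le_trans (RL p Lp).
      by rewrite -[leLHS]mulr1 ler_pM2l // ltr0n.
    have sB : (size (p :: B) <= Y.-1)%N.
      apply: leq_trans (size_mem_flatten BBs) _; rewrite BsE.
      rewrite /P /scale_primes /primes_in; do 2 rewrite size_filter (leq_trans (count_size _ _)) //.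
      have a0 : (0 < 2 ^ 2 ^ s)%N by rewrite expn_gt0.
      rewrite size_iota -/Y; move: (2 ^ 2 ^ s)%N a0 Y Y0 {YE lo hi} => a a0 b b0. lia.
    have H : ((i * size (p :: B)).+1 <= Y ^ 2)%N.
      apply: leq_trans (_ : (Y * Y.-1).+1 <= _)%N.
        by rewrite ltnS leq_mul // (leq_trans ip).
      by rewrite expnS expn1; case: (Y) Y0 => // y _; rewrite /= mulnS; lia.
    apply: leq_trans (leq_expn 2 H) _.
    by rewrite -expnM.
  apply: le_trans (_ : (2 ^+ (2 ^ (s + 3))) ^+ size Bs <= _).
    rewrite /brun_prod_size; elim: (Bs) bB => [|B Bs' IH] bB; first by rewrite big_nil.
    rewrite big_cons exprS ler_pM ?sqr_ge0 ?bB ?mem_head //.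
      by apply: prodr_ge0 => C _; apply: sqr_ge0.
    by apply: IH => C CB; apply: bB; rewrite in_cons CB orbT.
  rewrite -exprM ler_weXn2l ?ler1n // mulnC.
  by rewrite leq_mul2r szB' orbT.
Qed.

(* [tail4 n] is the sum of [(n + j) ^ 4 / 2 ^ j] over [j >= 1]. *)
Definition tail4 (n : nat) : nat := n ^ 4 + 8 * n ^ 3 + 36 * n ^ 2 + 104 * n + 150.

Lemma tail4S n : (2 * tail4 n = tail4 n.+1 + n.+1 ^ 4)%N.
Proof. by rewrite /tail4 -addn1; ring. Qed.

(** Induction from the top scale downwards. The squared sums telescope; the term with [tail4]
    reserves room in the exponent for all lower scales, and 150 is the sum of [i ^ 4 / 2 ^ i] over
    [i >= 1]. *)
Lemma blocks_upto R n : (6 < R)%N -> (n <= R - 21)%N ->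
  (forall i, (i <= R)%N -> i%:R * (96 * i%:R ^+ 2 * (i%:R + 1)) <= (2 ^ (R - 5))%:R :> QQ) ->
  exists Bs (e : nat), [/\ uniq (flatten Bs),
    forall p, (p \in flatten Bs) = (2 ^ (R - 5) < p)%N &&
      (p \in primes_in (2 ^ 2 ^ (R - 21 - n)) (2 ^ 2 ^ (R - 21))),
    {in Bs, forall B, esym1 (density R) B <= 1 / 2},
    \sum_(B <- Bs) esym1 (density R) B ^+ 2 <= 1 / 8 * (1 - n.+1%:R^-1) &
    [/\ (size Bs <= e)%N, brun_prod_size (fun p => (nclasses R p)%:R) Bs <= 2 ^+ e &
      (e + 385 * 2 ^ (R - 18 - n) * tail4 n <= 385 * 2 ^ (R - 18) * 150)%N]].
Proof.
move=> R6 + RL; elim: n => [|n IH] nR.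
  exists [::], 0%N; split=> //=.
  - move=> p; rewrite subn0 /primes_in /index_iota subnn in_nil; by rewrite andbF.
  - by rewrite big_nil invr1 subrr mulr0.
  - by rewrite /brun_prod_size big_nil expr0 subn0; split.
have [|Bs [e [uB BE B1 B2 [szB szp eE]]]] := IH; first exact: ltnW.
have si : (R - 21 - n.+1 + n.+1 = R - 21)%N by lia.
have [Cs [CE C1 C2 szC szpC]] := scale_blocks R6 erefl (RL n.+1 ltac:(lia)) si isT.
set s := (R - 21 - n.+1)%N in si CE C1 C2 szC szpC *.
have sE : (s.+1 = R - 21 - n)%N by rewrite /s; lia.
have mC p : (p \in flatten Cs) = (2 ^ (R - 5) < p)%N &&
      (p \in primes_in (2 ^ 2 ^ s) (2 ^ 2 ^ (R - 21 - n))).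
  by rewrite CE mem_filter sE.
exists (Cs ++ Bs), (385 * n.+1 ^ 4 * 2 ^ (s + 3) + e)%N; split.
- rewrite flatten_cat cat_uniq uB CE filter_uniq ?primes_in_uniq //= andbT.
  apply/hasPn => p; rewrite BE -CE mC !mem_primes_in => /andP[_ /and3P[_ lo _]].
  by apply/negP => /andP[_ /and3P[_ _]]; rewrite leqNgt lo.
- move=> p; rewrite flatten_cat mem_cat BE mC -andb_orr; congr (_ && _).
  rewrite (@primes_in_cat (2 ^ 2 ^ s) (2 ^ 2 ^ (R - 21 - n)) (2 ^ 2 ^ (R - 21))) ?mem_cat //.
    by rewrite -sE !leq_exp2l.
  by rewrite leq_exp2l // leq_exp2l // leq_subr.
- by move=> B; rewrite mem_cat => /orP[/C1|/B1].
- rewrite big_cat /=; apply: le_trans (lerD C2 B2) _.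
  by rewrite -mulrDr addrC addrA addrNK.
split.
- rewrite size_cat leq_add //; apply: leq_trans szC _.
  by rewrite leq_pmulr // expn_gt0.
- rewrite /brun_prod_size big_cat /= exprD ler_pM //.
    by apply: prodr_ge0 => B _; apply: sqr_ge0.
  by apply: prodr_ge0 => B _; apply: sqr_ge0.
- apply: leq_trans eE.
  have -> : (R - 18 - n = (s + 3).+1)%N by rewrite /s; lia.
  have -> : (R - 18 - n.+1 = s + 3)%N by rewrite /s; lia.
  have := tail4S n; rewrite (expnS 2 (s + 3)); move: (2 ^ (s + 3))%N (tail4 n) (tail4 n.+1) (n.+1 ^ 4)%N.
  move=> x t t' q T.
  have -> : (385 * (2 * x) * t = 385 * x * (2 * t))%N by ring.
  by rewrite T; lia.
Qed.

Lemma blocks_exist R : (21 <= R)%N ->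
  (forall i, (i <= R)%N -> i%:R * (96 * i%:R ^+ 2 * (i%:R + 1)) <= (2 ^ (R - 5))%:R :> QQ) ->
  exists Bs, [/\ uniq (flatten Bs),
    forall p, (p \in flatten Bs) = [&& prime p, 2 ^ (R - 5) < p & p <= 2 ^ 2 ^ (R - 21)]%N,
    {in Bs, forall B, esym1 (density R) B <= 1 / 2},
    \sum_(B <- Bs) esym1 (density R) B ^+ 2 <= 1 / 4 &
    (size Bs <= 2 ^ (R - 2))%N /\
    brun_prod_size (fun p => (nclasses R p)%:R) Bs <= 2 ^+ (2 ^ (R - 2))].
Proof.
move=> R21 RL; have [|Bs [e [uB BE B1 B2 [szB szp eE]]]] := blocks_upto _ (leqnn (R - 21)) RL.
  by apply: leq_trans R21.
have e2 : (e <= 2 ^ (R - 2))%N.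
  apply: leq_trans (leq_addr _ _) (leq_trans eE _).
  (* [385 * 150 = 57750] is below [2 ^ 16]. *)
  have -> : (R - 2 = 16 + (R - 18))%N by lia.
  rewrite expnD mulnAC leq_mul2r; apply/orP; right.
  by apply/ssrnat.leP/PeanoNat.Nat.leb_le; vm_compute.
exists Bs; split=> //.
- move=> p; rewrite BE mem_primes_in subnn; case: (prime p); rewrite ?andbF //=.
  case Lp : (_ < p)%N => //=; rewrite andbC; case: (p <= _)%N => //=.
  apply: leq_ltn_trans Lp; rewrite -[X in (X <= _)%N]/(2 ^ 1)%N leq_exp2l //; lia.
- apply: le_trans B2 _; have : 0 <= (R - 21).+1%:R^-1 :> QQ by rewrite invr_ge0.
  by move: (_^-1) => x x0; lra.
split; first exact: leq_trans e2.
by apply: le_trans szp _; rewrite ler_weXn2l ?ler1n.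
Qed.

(** * A good multiple *)

Definition hit (Q J p m : nat) : bool := has (fun k => p %| Q * m.+1 + k)%N (iota 1 J).

Lemma dvdn_add_inj p n k l : (k < l)%N -> (l <= p)%N -> (0 < k)%N ->
  (p %| n + k)%N -> (p %| n + l)%N -> false.
Proof.
move=> kl lp k0 pk pl.
have : (p %| l - k)%N by rewrite -(dvdn_addr _ pk) -addnA subnKC // ltnW.
by move/dvdn_leq; lia.
Qed.

(** As [J <= p], at most one of the [J] shifts is divisible by [p], so the indicator of the union is
    the sum of the indicators. *)
Lemma cong_poly_hit Q J p : (0 < Q)%N -> prime p -> coprime p Q -> (J <= p)%N ->
  cong_poly (pred1 p) (fun m => (hit Q J p m)%:R) (J%:R / p%:R) J%:R.
Proof.
move=> Q0 pp cpQ; have p0 := prime_gt0 pp; elim: J => [|J IH] Jp.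
  rewrite mul0r -[X in cong_poly _ _ _ X](@normr0 _ QQ).
  by apply: cong_poly_ext (cong_poly_const _ _).
have pnat : (pred1 p : nat_pred).-nat p by rewrite pnat_id.
rewrite -(natr1 J) mulrDl mul1r.
apply: cong_poly_ext (cong_polyD (IH (ltnW Jp)) (cong_poly_cong (resid Q p J.+1) pnat)) => m.
rewrite -resid_dvd // /hit -[J.+1 in RHS]addn1 iotaD has_cat /= add1n orbF.
case: hasP => [[k]|_]; last by rewrite add0r.
rewrite mem_iota => /andP[k0 kJ] pk; case pJ: (p %| _)%N => //=; last by rewrite addr0.
by have := dvdn_add_inj (_ : k < J.+1)%N Jp k0 pk pJ; rewrite -[J.+1]add1n => /(_ kJ).
Qed.

Definition mid_primes (R T k : nat) : seq nat :=
  [seq p <- primes_in (2 ^ 2 ^ (R - 20 - k)) (2 ^ 2 ^ R) |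
     (2 ^ (R - 5) < p)%N && (p ^ (8 * (T * k)) <= 2 ^ 2 ^ R)%N].

Lemma mem_mid_primes R T k p : (p \in mid_primes R T k) ->
  [/\ prime p, (2 ^ (R - 5) < p)%N, (2 ^ 2 ^ (R - 20 - k) < p)%N &
      (p ^ (8 * (T * k)) <= 2 ^ 2 ^ R)%N].
Proof. by rewrite mem_filter mem_primes_in => /andP[/andP[-> ->] /and3P[-> ->]]. Qed.

Lemma mid_primes_prime R T k : all prime (mid_primes R T k).
Proof. by apply/allP => p /mem_mid_primes[]. Qed.

Lemma mid_primes_uniq R T k : uniq (mid_primes R T k).
Proof. by rewrite filter_uniq ?primes_in_uniq. Qed.

(** Bounds by [M ^ (1 / 8)] the number of products of [T * k] such primes. Among [n > 0] distinct
    positive integers one is at least [n]. *)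
Lemma size_mid_primes R T k : (0 < T)%N -> (0 < k)%N ->
  (size (mid_primes R T k) ^ (8 * (T * k)) <= 2 ^ 2 ^ R)%N.
Proof.
move=> T0 k0; set s := mid_primes R T k.
have us : uniq s by apply: mid_primes_uniq.
have [/hasP[p ps sp]|/hasPn H] := boolP (has (fun p => size s <= p)%N s).
  have [_ _ _ le] := mem_mid_primes ps.
  by apply: leq_trans le; apply: leq_expn.
case sz : (size s) => [|n]; first by rewrite exp0n ?muln_gt0 ?T0 ?k0 // expn_gt0.
have : (size s <= size (iota 1 n))%N.
  apply: uniq_leq_size => // p ps; rewrite mem_iota add1n.
  have [pp _ _ _] := mem_mid_primes ps; have := H p ps.
  by rewrite -ltnNge sz => ->; rewrite prime_gt0.
by rewrite size_iota sz ltnn.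
Qed.

Lemma sum_inv_mid_primes R T k :
  \sum_(p <- mid_primes R T k) p%:R^-1 <= 2 * (20 + k)%:R :> QQ.
Proof.
set a := (R - 20 - k)%N.
apply: le_trans (_ : \sum_(p <- primes_in (2 ^ 2 ^ a) (2 ^ 2 ^ R)) p%:R^-1 <= _).
  rewrite big_filter big_mkcond; apply: ler_sum => p _.
  by case: ifP => // _; rewrite invr_ge0.
have := sum_inv_primes_scales a (R - a); rewrite subnKC /a ?leq_subLR; last lia.
move/le_trans; apply; rewrite ler_wpM2l // ?ler_nat; first lia.
Qed.

(** Rankin's parameter 4 beats the loss [2 ^+ (T * k)] from deleted primes, leaving [2 ^- (T * k)].
    The Euler product costs only [2 ^+ (32 * (20 + k) + 1)], since these primes span at most
    [20 + k] scales. *)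
Lemma sum_inv_mid_prods R T k : (9 <= R)%N -> (676 <= T)%N -> (0 < k)%N ->
  \sum_(d <- multiset_prods (mid_primes R T k) (T * k)) 2 ^+ (T * k) / d%:R <=
    2 ^- (k + 2) :> QQ.
Proof.
move=> R9 T676 k0; rewrite -mulr_sumr.
have L16 p : p \in mid_primes R T k -> 16 < p%:R :> QQ.
  move=> /mem_mid_primes[_ Lp _ _]; rewrite (ltr_nat QQ 16) (leq_ltn_trans _ Lp) //.
  by rewrite -[X in (X <= _)%N]/(2 ^ 4)%N leq_exp2l //; lia.
have H4 : {in mid_primes R T k, forall p, 4 < p%:R :> QQ} by move=> p /L16; lra.
have H1 : {in mid_primes R T k, forall p, 0 <= (4 : QQ) / p%:R <= 1 / 4}.
  move=> p /L16 p16; have p0 : 0 < p%:R :> QQ by lra.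
  by rewrite divr_ge0 ?(ltW p0) //= ler_pdivrMr //; lra.
have HS : esym1 (fun p => 4 / p%:R) (mid_primes R T k) <= (8 * (20 + k))%:R.
  rewrite /esym1 -mulr_sumr natrM.
  by have := sum_inv_mid_primes R T k; move: (\sum_(_ <- _) _) => x; lra.
have P := prod_1sub_ge_exp2 H1 HS.
have S := sum_inv_multiset_prods (T * k) (ltac:(lra) : 0 < 4 :> QQ) H4.
have e0 n : 0 < 2 ^+ n :> QQ by rewrite exprn_gt0 // ltr0n.
apply: le_trans (ler_wpM2l (ltW (e0 _)) S) _.
have {}P : (\prod_(p <- mid_primes R T k) (1 - 4 / p%:R))^-1 <= 2 ^+ (4 * (8 * (20 + k)) + 1) :> QQ.
  rewrite -[leRHS]invrK lef_pV2 // posrE ?invr_gt0 //.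
  by apply: lt_le_trans P; rewrite invr_gt0.
rewrite mulrA; have -> : 2 ^+ (T * k) * 4 ^- (T * k) = 2 ^- (T * k) :> QQ.
  rewrite (_ : 4 = 2 * 2 :> QQ); last by ring.
  by rewrite exprMn invfM mulrA mulfV ?mul1r // gt_eqF.
apply: le_trans (ler_wpM2l _ P) _; first by rewrite invr_ge0 ltW.
rewrite mulrC ler_pdivrMr // mulrC ler_pdivlMr // -exprD ler_weXn2l ?ler1n //.
(* [676 k >= (4 * (8 * (20 + k)) + 1) + (k + 2)] *)
apply: leq_trans (_ : 676 * k <= _)%N; last by rewrite leq_mul2r T676 orbT.
lia.
Qed.

Lemma sum_exp2V_le n : \sum_(k <- iota 1 n) 2 ^- (k + 2) <= 1 / 4 - 2 ^- (n + 2) :> QQ.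
Proof.
elim: n => [|n IH]; first by rewrite big_nil add0n expr2 invfM; lra.
rewrite -[X in iota _ X]addn1 iotaD big_cat /= big_seq1 add1n.
apply: le_trans (lerD IH (lexx _)) _.
rewrite addSn exprS invfM; have : 2 ^- (n + 2) != 0 :> QQ by rewrite invr_neq0 ?expf_neq0 ?pnatr_eq0.
by move: (2 ^- (n + 2)) => x _; lra.
Qed.

Lemma good_shift R T : (27 <= R)%N -> (676 <= T)%N ->
  (forall i, (i <= R)%N -> i%:R * (96 * i%:R ^+ 2 * (i%:R + 1)) <= (2 ^ (R - 5))%:R :> QQ) ->
  let L := (2 ^ (R - 5))%N in
  exists2 m, (m < 2 ^ 2 ^ R)%N & forall k, (0 < k <= L)%N ->
    let N := (multQ L * m.+1 + k)%N in
    (forall p, prime p -> (L < p)%N -> (p <= 2 ^ 2 ^ (R - 20 - k))%N -> ~~ (p %| N)%N) /\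
    (\sum_(p <- mid_primes R T k) logn p N < T * k)%N.
Proof.
move=> R27 T676 RL L; set Q := multQ L; have Q0 : (0 < Q)%N by apply: multQ_gt0.
have [|Bs [uB BE B1 B2 [szB szp]]] := blocks_exist _ RL; first by apply: leq_trans R27.
have RltL : (R < L)%N.
  rewrite /L; have := ltn_expl (R - 10) (isT : 1 < 2)%N; have -> : (R - 5 = 5 + (R - 10))%N by lia.
  by rewrite expnD; move: (2 ^ (R - 10))%N => x; lia.
have L32 : (2 < L)%N by apply: leq_ltn_trans RltL; lia.
have pB : all prime (flatten Bs) by apply/allP => p; rewrite BE => /and3P[].
(* The classes of [m] for which the shift by [k] is divisible by a product of [T * k] medium
   primes. *)
pose E := flatten [seq [seq (d, resid Q d k) | d <- multiset_prods (mid_primes R T k) (T * k)]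
                  | k <- iota 1 L].
have EP e : e \in E -> exists k, [/\ (0 < k)%N, (k <= L)%N,
    e.1 \in multiset_prods (mid_primes R T k) (T * k) & e.2 = resid Q e.1 k].
  move=> /flatten_mapP[k]; rewrite mem_iota add1n ltnS => /andP[k0 kL] /mapP[d dk ->].
  by exists k.
have cop k d : d \in multiset_prods (mid_primes R T k) (T * k) -> coprime d Q.
  move=> dk; apply: contraT => nc.
  have d0 := multiset_prods_gt0 (mid_primes_prime R T k) dk.
  have g1 : (1 < gcdn d Q)%N.
    by move: nc; rewrite /coprime; have : (0 < gcdn d Q)%N by [rewrite gcdn_gt0 d0]; lia.
  have pp := pdiv_prime g1; have pg := pdiv_dvd (gcdn d Q); set p := pdiv _ in pp pg.
  have pd := dvdn_trans pg (dvdn_gcdl _ _); have pQ := dvdn_trans pg (dvdn_gcdr _ _).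
  have [_ Lp _ _] := mem_mid_primes (multiset_prods_prime_dvd (mid_primes_prime R T k) dk pp pd).
  by have := coprime_multQ pp Lp; rewrite prime_coprime // -/Q pQ.
have Jle p : (nclasses R p <= R)%N by rewrite /nclasses; lia.
have [|||||||m [mM m1 m2]] := @sieve_exists (fun p m => hit Q (nclasses R p) p m) (density R)
    (fun p => (nclasses R p)%:R) Bs E (2 ^ 2 ^ R) uB pB.
- move=> p; rewrite BE => /and3P[pp Lp _].
  apply: cong_poly_hit => //; first exact: coprime_multQ.
  by apply: leq_trans (Jle p) _; apply: ltnW; apply: ltn_trans Lp.
- by move=> p _; apply: density_ge0.
- exact: B1.
- exact: B2.
- move=> e /EP[k [k0 kL ek er]].
  have d0 := multiset_prods_gt0 (mid_primes_prime R T k) ek; split=> // m p mr pin pd.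
  have pp := allP pB p pin.
  have [_ Lp zp _] := mem_mid_primes (multiset_prods_prime_dvd (mid_primes_prime R T k) ek pp pd).
  apply/hasPn => l; rewrite mem_iota add1n ltnS => /andP[l0 lJ]; apply/negP => pl.
  (* A prime of [d] exceeds [z_k], hence is sieved only from shifts [l < k]; it cannot divide both
     the shift by [l] and the shift by [k]. *)
  have lk : (l < k)%N by move: lJ (leq_scale zp) l0 k0; rewrite /nclasses; clear; lia.
  have pk : (p %| Q * m.+1 + k)%N.
    by apply: dvdn_trans pd _; rewrite resid_dvd ?(cop k) // mr er.
  by have := dvdn_add_inj lk (ltnW (leq_ltn_trans kL Lp)) l0 pl pk.
- rewrite big_flatten big_map /=.
  apply: le_trans (_ : \sum_(k <- iota 1 L) 2 ^- (k + 2) <= _); last first.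
    apply: le_trans (sum_exp2V_le L) _; have : 0 <= 2 ^- (L + 2) :> QQ by rewrite invr_ge0 exprn_ge0.
    by move: (_^-1) => x x0; lra.
  rewrite big_seq [leRHS]big_seq; apply: ler_sum => k; rewrite mem_iota => /andP[k0 _].
  apply: le_trans (sum_inv_mid_prods _ T676 k0); last by apply: leq_trans R27.
  rewrite big_map /= big_seq [leRHS]big_seq; apply: ler_sum => d dk.
  rewrite ler_wpM2r ?invr_ge0 // ler_weXn2l ?ler1n //.
  exact: multiset_prods_count (mid_primes_prime R T k) dk.
(* [V = M ^ (1 / 8)]. The main term is at least [V ^ 6 / 2], the error at most
   [(1 + V + V ^ 2) * V ^ 2]. *)
- pose V := (2 ^ 2 ^ (R - 3))%N.
  have V16 : (16 <= V)%N.
    by rewrite /V -[X in (X <= _)%N]/(2 ^ 2 ^ 2)%N !leq_exp2l //; lia.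
  have ME : (2 ^ 2 ^ R = V ^ 8)%N.
    by rewrite /V -expnM -[8%N]/(2 ^ 3)%N -expnD; congr (_ ^ (_ ^ _))%N; lia.
  have SE : (2 ^ 2 ^ (R - 2) = V ^ 2)%N.
    by rewrite /V -expnM -expnSr; congr (_ ^ (_ ^ _))%N; lia.
  have LV : (L <= V)%N.
    by rewrite /L /V leq_exp2l //; apply: leq_trans (ltnW (ltn_expl (R - 3) (isT : 1 < 2)%N)); lia.
  have BV : (size Bs <= V)%N.
    apply: leq_trans szB _; rewrite /V leq_exp2l //.
    by have := ltn_expl (R - 3) (isT : 1 < 2)%N; lia.
  have EV : (size E <= V ^ 2)%N.
    rewrite /E size_flatten /shape -map_comp sumnE big_map.
    apply: leq_trans (_ : \sum_(k <- iota 1 L) V <= _)%N.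
      rewrite big_seq [leqRHS]big_seq; apply: leq_sum => k; rewrite mem_iota => /andP[k0 _].
      rewrite /= size_map (leq_trans (size_multiset_prods _ _)) //.
      rewrite -(@leq_exp2r _ _ 8) // -expnM mulnC -ME size_mid_primes //.
      by apply: leq_trans T676.
    by rewrite big_const_seq count_predT iter_addn_0 size_iota expnS expn1 leq_mul.
  have mu2 : V%:R ^- 2 <= brun_prod (density R) Bs.
    rewrite -natrX -SE natrX; apply: le_trans (_ : 2 ^- size Bs <= _).
      by rewrite lef_pV2 ?posrE ?exprn_gt0 ?ltr0n // ler_weXn2l ?ler1n.
    rewrite -exprVn /brun_prod.
    elim: (Bs) B1 => [|B Bs' IH] H; first by rewrite big_nil.
    rewrite big_cons exprS ler_pM ?exprn_ge0 ?invr_ge0 //.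
      have /andP[l _] := brun_bounds (fun p _ => density_ge0 R p) (H B (mem_head _ _)).
      by apply: le_trans l; lra.
    by apply: IH => C CB; apply: H; rewrite in_cons CB orbT.
  have sg2 : brun_prod_size (fun p => (nclasses R p)%:R) Bs <= V%:R ^+ 2.
    by rewrite -natrX -SE natrX.
  have V0 : 16 <= V%:R :> QQ by rewrite (ler_nat QQ 16).
  have BE2 : (1 + size Bs + size E)%:R <= 1 + V%:R + V%:R ^+ 2 :> QQ.
    by rewrite !natrD !lerD ?ler_nat // -natrX ler_nat.
  apply: le_lt_trans (_ : (1 + V%:R + V%:R ^+ 2) * V%:R ^+ 2 < _).
    apply: ler_pM => //; apply: prodr_ge0 => B _; exact: sqr_ge0.
  rewrite ME; apply: lt_le_trans (_ : V%:R ^+ 6 / 2 <= _); last first.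
    rewrite ler_pM2r ?invr_gt0 ?ltr0n //.
    have -> : V%:R ^+ 6 = (V ^ 8)%:R * V%:R ^- 2 :> QQ.
      by rewrite natrX -[8%N]/(6 + 2)%N exprD mulfK // expf_neq0 // gt_eqF //; lra.
    by rewrite ler_wpM2l.
  move: (V%:R) V0 => x x16; rewrite -[6%N]/(4 + 2)%N exprD mulrAC ltr_pM2r; last first.
    by rewrite exprn_gt0 //; lra.
  have x2 : 256 <= x ^+ 2 by nra.
  have -> : x ^+ 4 = x ^+ 2 * x ^+ 2 by ring.
  by move: (x ^+ 2) (expr2 x) x2 => y yE y2; nra.
exists m => // k /andP[k0 kL] N; split.
  move=> p pp Lp pz; have p2 : (2 < p)%N by apply: ltn_trans Lp.
  have pin : p \in flatten Bs.
    rewrite BE pp Lp /=; apply: leq_trans pz _; rewrite leq_exp2l // leq_exp2l //; lia.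
  have /hasPn := m1 p pin; apply; rewrite mem_iota k0 add1n ltnS.
  by move: (scale_ltn p2 pz) k0; rewrite /nclasses; clear; lia.
rewrite ltnNge; apply/negP => tk.
have N0 : (0 < N)%N by rewrite addn_gt0 k0 orbT.
have [d dk dN] := multiset_prods_dvd (mid_primes_uniq R T k) (mid_primes_prime R T k) N0 tk.
have eE : (d, resid Q d k) \in E.
  by apply/flatten_mapP; exists k; rewrite ?mem_iota ?k0 ?add1n ?ltnS // map_f.
have := m2 _ eE; rewrite /= -resid_dvd ?dN //; last exact: cop dk.
exact: multiset_prods_gt0 (mid_primes_prime R T k) dk.
Qed.

(** The size condition of [scale_blocks]. By monotonicity [i = R] suffices; the bound holds at
    [R = 40], and beyond that a unit step less than doubles the quartic. *)
Lemma quartic_le_exp2 R i : (40 <= R)%N -> (i <= R)%N ->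
  i%:R * (96 * i%:R ^+ 2 * (i%:R + 1)) <= (2 ^ (R - 5))%:R :> QQ.
Proof.
move=> R40 iR; set f := fun x : QQ => x * (96 * x ^+ 2 * (x + 1)).
apply: le_trans (_ : f R%:R <= _).
  have i0 : 0 <= i%:R :> QQ by []. have iR' : i%:R <= R%:R :> QQ by rewrite ler_nat.
  rewrite /f; apply: ler_pM => //; first by rewrite !mulr_ge0 ?exprn_ge0 ?addr_ge0.
  by rewrite ler_pM ?mulr_ge0 ?exprn_ge0 ?addr_ge0 // ?lerD2r // ler_wpM2l // lerXn2r ?nnegrE.
rewrite natrX; have -> : (R - 5 = (R - 40) + 35)%N by clear -R40; lia.
have {1}-> : R = (R - 40 + 40)%N by clear -R40; lia.
elim: (R - 40)%N => [|n IH] {i iR R40}; first by rewrite add0n /f; lra.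
rewrite addSn exprS -(natr1 (n + 40)); have x40 : 40 <= (n + 40)%:R :> QQ by rewrite (ler_nat QQ 40) leq_addl.
move: (n + 40)%:R (2 ^+ (n + 35)) x40 IH => x y x40; rewrite /f => IH.
apply: le_trans (ler_wpM2l _ IH); last by [].
have x2 : 40 * x <= x ^+ 2 by nra.
have x3 : 40 * x ^+ 2 <= x ^+ 3 by rewrite exprS ler_wpM2r // sqr_ge0.
rewrite -subr_ge0.
have -> : 2 * (x * (96 * x ^+ 2 * (x + 1))) - (x + 1) * (96 * (x + 1) ^+ 2 * (x + 1 + 1))
  = 96 * (x + 1) * (x ^+ 3 - 4 * x ^+ 2 - 5 * x - 2) by ring.
by rewrite !mulr_ge0 //; lra.
Qed.

(** * Linear growth of [Omega] along the shifts *)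

Local Open Scope nat_scope.

Lemma leq_sum_uniq_subset (s t : seq nat) (f : nat -> nat) : uniq s -> uniq t ->
  {subset s <= t} -> \sum_(p <- s) f p <= \sum_(p <- t) f p.
Proof.
move=> us ut st; rewrite [leqRHS](bigID (fun p => p \in s)) /= -[X in _ <= X + _]big_filter.
have -> : \sum_(p <- [seq p <- t | p \in s]) f p = \sum_(p <- s) f p.
  apply: perm_big; apply: uniq_perm; rewrite ?filter_uniq // => p.
  by rewrite mem_filter; case ps: (p \in s); rewrite //= st.
exact: leq_addr.
Qed.

Lemma Omega_le_linear R T : 40 <= R -> 676 <= T ->
  exists2 n, R - 5 < n & forall k, 0 < k -> Omega (n + k) <= (17 * T).+1 * k.
Proof.
move=> R40 T676; set L := 2 ^ (R - 5); set Q := multQ L.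
have [|m mM good] := @good_shift R T _ T676 (fun i => @quartic_le_exp2 R i R40).
  by clear -R40; lia.
set M := 2 ^ 2 ^ R in mM.
have Q0 : 0 < Q by apply: multQ_gt0.
have L0 : 0 < L by rewrite expn_gt0.
have ME : M = 2 ^ (32 * L).
  by rewrite /M /L -[32]/(2 ^ 5) -expnD; congr (_ ^ (_ ^ _)); clear -R40; lia.
have QM : Q.*2 <= M.
  rewrite -mul2n ME; apply: leq_trans (_ : 2 * 2 ^ (12 * L) <= _).
    by rewrite leq_pmul2l // multQ_leq.
  by rewrite -expnS leq_exp2l //; move: L0; clear; lia.
have LM : L <= M.
  by rewrite ME; apply: leq_trans (ltnW (ltn_expl L (isT : 1 < 2))) _; rewrite leq_exp2l // leq_pmull.
have M0 : 1 < M by rewrite ME -[X in X < _](expn0 2) ltn_exp2l // muln_gt0 L0.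
have QmM : Q * m.+1 <= Q * M by rewrite leq_mul2l mM orbT.
have nM : Q * m.+1 + L <= M ^ 2.
  apply: leq_trans (_ : Q.*2 * M <= _); last by rewrite expnS expn1 leq_mul.
  rewrite -addnn mulnDl leq_add //; apply: leq_trans LM _.
  by rewrite leq_pmull.
(* [Q] is a multiple of [2 ^ (R - 5).+1], so [n] is unbounded as [R] grows. *)
exists (Q * m.+1).
  apply: leq_trans (_ : Q <= _); last by rewrite leq_pmulr.
  have L2 : 2 <= L by rewrite /L -[X in X <= _](expn1 2) leq_exp2l //; clear -R40; lia.
  have := dvdn_leq Q0 (dvdn_multQ (isT : prime 2) L2).
  rewrite trunc_expnK // => /(leq_trans _); apply.
  by apply: leq_trans (ltn_expl _ (isT : 1 < 2)) _; rewrite leq_exp2l.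
(* For [k > L], [n <= M ^ 2 = 2 ^ (64 * L)], so [n + k <= 2 * 2 ^ (64 * k)]. *)
move=> k k0; have [kL|Lk] := leqP k L; last first.
  have N0 : 0 < Q * m.+1 + k by rewrite addn_gt0 k0 orbT.
  apply: leq_trans (_ : 65 * k <= _); last by rewrite leq_mul2r; apply/orP; right; move: T676; clear; lia.
  rewrite -(leq_exp2l (m := 2)) //; apply: leq_trans (Omega_exp2 N0) _.
  apply: leq_trans (_ : 2 * 2 ^ (64 * k) <= _); last by rewrite -expnS leq_exp2l //; move: k0; clear; lia.
  rewrite mul2n -addnn leq_add //.
    apply: leq_trans (leq_trans (leq_addr L _) nM) _.
    by rewrite ME -expnM leq_exp2l //; move: Lk; clear; lia.
  by apply: leq_trans (ltnW (ltn_expl k (isT : 1 < 2))) _; rewrite leq_exp2l // leq_pmull.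
have [|g1 g2] := good k _; first by rewrite k0.
rewrite -/L -/Q in g1 g2; set N := Q * m.+1 + k in g1 g2 *.
have N0 : 0 < N by rewrite addn_gt0 k0 orbT.
have NM : N <= M ^ 2 by apply: leq_trans nM; rewrite leq_add2l.
set e := 8 * (T * k) in g2.
have e0 : 0 < e by rewrite /e !muln_gt0 k0 andbT; move: T676; clear; lia.
have uN := primes_uniq N; have pN : all prime (primes N).
  by apply/allP => p; rewrite mem_primes => /and3P[].
rewrite /Omega (bigID (fun p => p <= L)) /=.
rewrite [X in _ + X](bigID (fun p => p ^ e <= M)) /=.
(* Here the valuations of [N] are those of [k], and at most [log2 k] prime factors divide [k]. *)
have S1 : \sum_(p <- primes N | p <= L) logn p N <= k.
  rewrite big_seq_cond (eq_bigr (fun p => logn p k)) => [|p]; last first.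
    by rewrite mem_primes => /andP[/and3P[pp _ _] pL]; apply: logn_multQ_add.
  rewrite -big_seq_cond -big_filter.
  apply: leq_trans (ltnW (ltn_expl _ (isT : 1 < 2))) _.
  rewrite -[leqRHS]expn1; apply: logn_sum_bound; rewrite ?filter_uniq //.
    by apply/allP => p; rewrite mem_filter => /andP[_ /(allP pN)].
  by move=> p; rewrite mem_filter expn1 => /andP[_ /(allP pN) /prime_gt1].
have S2 : \sum_(p <- primes N | ~~ (p <= L) && (p ^ e <= M)) logn p N <= T * k.
  apply: leq_trans (ltnW g2); rewrite -big_filter.
  apply: leq_sum_uniq_subset; rewrite ?mid_primes_uniq ?filter_uniq // => p.
  rewrite mem_filter mem_primes -ltnNge => /andP[/andP[Lp pe] /and3P[pp _ pdN]].
  rewrite mem_filter Lp pe mem_primes_in pp /=; apply/andP; split.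
    by rewrite ltnNge; apply/negP => pz; have := g1 p pp Lp pz; rewrite pdN.
  by apply: leq_trans pe; rewrite -[X in X <= _](expn1 p) leq_exp2l // prime_gt1.
(* These primes exceed [M ^ (1 / e)] and [N <= M ^ 2], so there are at most [2 * e = 16 * (T * k)]
   of them with multiplicity. *)
have S3 : \sum_(p <- primes N | ~~ (p <= L) && ~~ (p ^ e <= M)) logn p N <= 16 * (T * k).
  rewrite -big_filter -(leq_exp2l _ _ M0).
  apply: leq_trans (_ : N ^ e <= _).
    apply: logn_sum_bound; rewrite ?filter_uniq //.
      by apply/allP => p; rewrite mem_filter => /andP[_ /(allP pN)].
    by move=> p; rewrite mem_filter -!ltnNge => /andP[/andP[_ /ltnW]].
  apply: leq_trans (leq_expn e NM) _.
  by rewrite -expnM leq_exp2l // /e mulnA.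
apply: leq_trans (leq_add S1 (leq_add S2 S3)) _.
by clear; lia.
Qed.

End Development.

Open Scope R_scope.

Theorem theorem1p1 :
  exists C : R, 0 < C /\
    (forall N : nat, exists n : nat, (N < n)%nat /\
       forall k : nat, (0 < k)%nat ->
         (omega (n + k) <= Omega (n + k))%nat /\
         INR (Omega (n + k)) <= C * INR k /\
         INR (tau (n + k)) <= Rpower 2 (C * INR k)).
Proof.
have [c cH] : exists c : nat, (0 < c)%N /\ forall N : nat, exists2 n, (N < n)%N &
    forall k, (0 < k)%N -> (Omega (n + k) <= c * k)%N.
  exists (17 * 676).+1; split=> // N.
  have [n nN nO] := @Omega_le_linear (N + 40) 676 (leq_addl _ _) (leqnn _).
  by exists n => //; apply: leq_trans nN; lia.
have [c0 {}cH] := cH; exists (INR c); split; first by apply: lt_0_INR; apply/ssrnat.ltP.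
move=> N; have [n Nn nO] := cH N; exists n; split=> // k k0.
split; first exact: omega_le_Omega.
rewrite -mult_INR; split; first by apply: le_INR; apply/ssrnat.leP; apply: nO.
rewrite Rpower_pow; last exact: Rlt_0_2.
have -> : 2 ^ (c * k) = INR (expn 2 (c * k)).
  elim: (c * k)%N => [|j IH] //; by rewrite expnS mult_INR -IH.
apply: le_INR; apply/ssrnat.leP.
have nk0 : (0 < n + k)%N by rewrite addn_gt0 k0 orbT.
by apply: leq_trans (tau_le_Omega nk0) _; rewrite leq_exp2l // nO.
Qed.
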